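(* Let $X$ and $Y$ be represented spaces and let $f:\subseteq X\rightrightarrows Y$ be a problem. Then the following are equivalent: (1) $f:\subseteq X\rightrightarrows Y$ is low; (2) $f:\subseteq X\rightrightarrows Y^{\mathsf{L}}$ is computable; (3) $f:\subseteq X^{\mathsf{L}}\rightrightarrows Y^{\mathsf{L}}$ is computable; (4) $f:\subseteq X_{\mathsf{J}}\rightrightarrows Y_{\mathsf{J}}$ is computable; (5) $f:\subseteq X_{\mathsf{J}}\rightrightarrows Y_{\mathsf{J}}$ is computable relative to the halting problem $0'$.
   Context: $F:\subseteq A\to B$ denotes a partial function, $f:\subseteq A\rightrightarrows B$ a partial multi-valued function (nonempty values on its domain). Compositions of partial functions have their natural domain. A representation of a set $X$ is a surjective partial function $\delta_X:\subseteq\mathbb{N}^{\mathbb{N}}\to X$; $(X,\delta_X)$ is then a represented space. A problem is a partial multi-valued function $f:\subseteq X\rightrightarrows Y$ between represented spaces. $F:\subseteq\mathbb{N}^{\mathbb{N}}\to\mathbb{N}^{\mathbb{N}}$ is a realizer of $f$ if $\delta_YF(p)\in f\delta_X(p)$ for all $p\in\mathrm{dom}(f\delta_X)$. A problem is computable, low, or computable relative to an oracle if it has a realizer with that property. A partial function $F:\subseteq\mathbb{N}^{\mathbb{N}}\to\mathbb{N}^{\mathbb{N}}$ is computable if there is a Turing machine (infinite input tape, one-way output tape) that on each $p\in\mathrm{dom}(F)$ produces $F(p)$ in the long run; nothing is required outside $\mathrm{dom}(F)$. It is computable relative to $q\in\mathbb{N}^{\mathbb{N}}$ if there is a computable $G$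 with $F(p)=G\langle q,p\rangle$ for all $p\in\mathrm{dom}(F)$, where $\langle p,q\rangle(2n):=p(n)$, $\langle p,q\rangle(2n+1):=q(n)$. With $\langle n,k\rangle:=\frac12(n+k)(n+k+1)+k$ and $\langle p_0,p_1,\dots\rangle\langle n,k\rangle:=p_n(k)$, let $\lim:\subseteq\mathbb{N}^{\mathbb{N}}\to\mathbb{N}^{\mathbb{N}}$, $\langle p_0,p_1,\dots\rangle\mapsto\lim_{i\to\infty}p_i$ (product topology). The Turing jump $\mathsf{J}:\mathbb{N}^{\mathbb{N}}\to\mathbb{N}^{\mathbb{N}}$ is given by $\mathsf{J}(p)(i)=1$ if the $i$-th Turing machine halts upon input $p$, and $0$ otherwise; it is injective with partial inverse $\mathsf{J}^{-1}$. The halting problem is $0':=\mathsf{J}(000\dots)$. Let $\mathsf{L}:=\mathsf{J}^{-1}\circ\lim$. A partial function $F:\subseteq\mathbb{N}^{\mathbb{N}}\to\mathbb{N}^{\mathbb{N}}$ is low if $F=\mathsf{L}\circ G$ for some computable $G:\subseteq\mathbb{N}^{\mathbb{N}}\to\mathbb{N}^{\mathbb{N}}$. For a represented space $(X,\delta_X)$: $X^{\mathsf{L}}$ is the set $X$ with representation $\delta_X\circ\mathsf{L}$, and $X_{\mathsf{J}}$ is the set $X$ with representation $\delta_X\circ\mathsf{J}^{-1}$. In (2)–(5) the same multi-valued map $f$ is considered with respect to the changed representations. *)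

(* Defs.v *)
From HB Require Import structures.
From mathcomp Require Import all_boot.
From mathcomp Require Import boolp classical_sets topology.

Set Implicit Arguments.
Unset Strict Implicit.
Unset Printing Implicit Defensive.

Local Open Scope classical_set_scope.

Definition pfun (A B : Type) := A -> option B.

Definition pdom A B (F : pfun A B) : set A := [set a | exists b, F a = Some b].

Definition pcomp A B C (G : pfun B C) (F : pfun A B) : pfun A C :=
  fun a => obind G (F a).

Definition psurjective A B (F : pfun A B) := forall b, exists a, F a = Some b.

(* [R] is meant to be single-valued; every use below comes with a proof. *)
Definition pfun_of_rel A B (R : A -> B -> Prop) : pfun A B := fun a =>
  if pselect (exists b, R a b) is left e then Some (projT1 (cid e)) else None.

Lemma pfun_of_relP A B (R : A -> B -> Prop) :
  (forall a b b', R a b -> R a b' -> b = b') ->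
  forall a b, pfun_of_rel R a = Some b <-> R a b.
Proof.
move=> Runiq a b; rewrite /pfun_of_rel; case: pselect => [e|ne]; last first.
  by split=> // Rab; case: ne; exists b.
case: cid => b' /= Rab'; split=> [[<-]//|Rab].
by rewrite (Runiq _ _ _ Rab Rab').
Qed.

Definition baire := nat -> nat.

Definition pair_nat (n k : nat) : nat := ((n + k) * (n + k).+1)./2 + k.

Fixpoint unpair_nat (c : nat) : nat * nat :=
  if c is c'.+1 then
    let: (n, k) := unpair_nat c' in
    if n is n'.+1 then (n', k.+1) else (k.+1, 0)
  else (0, 0).

Lemma pair_natS0 k : pair_nat k.+1 0 = (pair_nat 0 k).+1.
Proof.
rewrite /pair_nat !addn0 add0n mulnC -addn2 mulnDl.
by rewrite [2 * _]mul2n halfD doubleK odd_double andbF add0n mulnC addnS.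
Qed.

Lemma pair_natSS n k : pair_nat n k.+1 = (pair_nat n.+1 k).+1.
Proof. by rewrite /pair_nat addSnnS !addnS. Qed.

Lemma pair_natK n k : unpair_nat (pair_nat n k) = (n, k).
Proof.
have [m] := ubnP (pair_nat n k); elim: m n k => // m IHm n k.
case: k => [|k]; first case: n => [//|n].
  by rewrite pair_natS0 ltnS => /IHm /= ->.
by rewrite pair_natSS ltnS => /IHm /= ->.
Qed.

Definition join_baire (q p : baire) : baire :=
  fun n => if odd n then p n./2 else q n./2.

Definition column (p : baire) (n : nat) : baire := fun k => p (pair_nat n k).

(* Multi-tape machines given by finite lists of quadruples in the sense of
   Post and Davis, each extended by the tape to be scanned.  There are a
   two-way read-only input tape, two-way infinite work tapes (a machine only
   touches the finitely many ones it mentions) and a one-way write-only output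
   tape.  Symbols are natural numbers, and 0 is the blank; a machine mentions
   only finitely many, so its alphabet is finite. *)

Inductive tape_name := Input | Work of nat.

Inductive action :=
  | MoveLeft of tape_name
  | MoveRight of tape_name
  | Write of nat & nat (* work tape, symbol *)
  | Emit of nat. (* appends a symbol to the output tape *)

Record quadruple := Quadruple {
  state : nat;
  scan : tape_name;
  symbol : nat;
  act : action;
  next : nat }.

(* The first applicable quadruple fires; if there is none, the machine halts.
   The initial state is 0. *)
Definition machine := seq quadruple.

(* [(l, r)]: [l] is the tape to the left of the head, nearest cell first, and
   [r] the tape from the scanned cell on; all remaining cells are blank. *)
Definition tape : Type := seq nat * seq nat.

Definition tape_read (t : tape) := head 0 t.2.
Definition tape_write a (t : tape) : tape := (t.1, a :: behead t.2).
Definition tape_left (t : tape) : tape := (behead t.1, head 0 t.1 :: t.2).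
Definition tape_right (t : tape) : tape := (head 0 t.2 :: t.1, behead t.2).

(* On tapes, the point [p] of Baire space is the infinite word
   1^(p 0) 2 1^(p 1) 2 1^(p 2) 2 ...; this is the part for p 0, ..., p (n-1). *)
Definition word (p : baire) (n : nat) : seq nat :=
  flatten [seq rcons (nseq (p i) 1) 2 | i <- iota 0 n].

(* Cell 0 of the input tape is blank and marks its left end.  The word of [p]
   starts in cell 1; [word p j.+1] is long enough to cover position [j]. *)
Definition input_symbol (p : baire) (h : nat) : nat :=
  if h is j.+1 then nth 0 (word p j.+1) j else 0.

Record config := Config {
  cstate : nat;
  input_head : nat;
  work : nat -> tape;
  output : seq nat }.

Definition init : config := Config 0 0 (fun=> ([::], [::])) [::].

Definition set_work (w : nat -> tape) i t : nat -> tape :=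
  fun j => if j == i then t else w j.

Definition read (p : baire) (c : config) (t : tape_name) : nat :=
  match t with
  | Input => input_symbol p (input_head c)
  | Work i => tape_read (work c i)
  end.

Definition perform (a : action) (s : nat) (c : config) : config :=
  let: Config _ h w o := c in
  match a with
  | MoveLeft Input => Config s h.-1 w o
  | MoveRight Input => Config s h.+1 w o
  | MoveLeft (Work i) => Config s h (set_work w i (tape_left (w i))) o
  | MoveRight (Work i) => Config s h (set_work w i (tape_right (w i))) o
  | Write i b => Config s h (set_work w i (tape_write b (w i))) o
  | Emit b => Config s h w (rcons o b)
  end.

Definition applicable (p : baire) (c : config) : pred quadruple :=
  fun r => (state r == cstate c) && (symbol r == read p c (scan r)).

Definition halted (M : machine) (p : baire) (c : config) : bool :=
  ~~ has (applicable p c) M.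

Definition step (M : machine) (p : baire) (c : config) : config :=
  if [seq r <- M | applicable p c r] is r :: _ then perform (act r) (next r) c
  else c.

Definition run (M : machine) (p : baire) (t : nat) : config :=
  iter t (step M p) init.

Definition halts (M : machine) (p : baire) : Prop :=
  exists t, halted M p (run M p t).

(* The output tape is filled with the word of [q] in the long run. *)
Definition produces (M : machine) (p q : baire) : Prop :=
  forall n, exists t, prefix (word q n) (output (run M p t)).

Definition decode_tape (n : nat) : tape_name :=
  if n is i.+1 then Work i else Input.

Definition decode_action (n : nat) : action :=
  let: (c, m) := unpair_nat n in
  match c with
  | 0 => MoveLeft (decode_tape m)
  | 1 => MoveRight (decode_tape m)
  | 2 => Emit m
  | i.+3 => Write i m
  end.

Definition decode_quadruple (n : nat) : quadruple :=
  let: (q, n) := unpair_nat n in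
  let: (t, n) := unpair_nat n in
  let: (b, n) := unpair_nat n in
  let: (a, q') := unpair_nat n in
  Quadruple q (decode_tape t) b (decode_action a) q'.

Fixpoint decode_seq (fuel n : nat) : machine :=
  match fuel, n with
  | fuel'.+1, n'.+1 =>
      let: (r, m) := unpair_nat n' in
      decode_quadruple r :: decode_seq fuel' m
  | _, _ => [::]
  end.

(* The tail of a nonempty list has a smaller code than the list, so the fuel
   [i] suffices. *)
Definition machine_of (i : nat) : machine := decode_seq i i.

Definition code_tape (t : tape_name) : nat := if t is Work i then i.+1 else 0.

Definition code_action (a : action) : nat :=
  match a with
  | MoveLeft t => pair_nat 0 (code_tape t)
  | MoveRight t => pair_nat 1 (code_tape t)
  | Emit b => pair_nat 2 b
  | Write i b => pair_nat i.+3 b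
  end.

Definition code_quadruple (r : quadruple) : nat :=
  pair_nat (state r) (pair_nat (code_tape (scan r))
    (pair_nat (symbol r) (pair_nat (code_action (act r)) (next r)))).

Fixpoint code_machine (M : machine) : nat :=
  if M is r :: M' then (pair_nat (code_quadruple r) (code_machine M')).+1
  else 0.

Lemma code_tapeK : cancel code_tape decode_tape. Proof. by case. Qed.

Lemma code_actionK : cancel code_action decode_action.
Proof.
by case=> [t|t|i b|b]; rewrite /decode_action /code_action pair_natK ?code_tapeK.
Qed.

Lemma code_quadrupleK : cancel code_quadruple decode_quadruple.
Proof.
case=> q t b a q'; rewrite /decode_quadruple /code_quadruple /=.
by rewrite !pair_natK code_tapeK code_actionK.
Qed.

HB.instance Definition _ := Countable.copy quadruple (can_type code_quadrupleK).

Lemma code_machineK : cancel code_machine machine_of.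
Proof.
rewrite /machine_of => M; have := leqnn (code_machine M).
elim: M {2 3}(code_machine M) => [|r M IHM] [|k] //= le_k.
rewrite pair_natK code_quadrupleK IHM //.
by rewrite -ltnS (leq_trans _ le_k) // ltnS leq_addl.
Qed.

Definition jump (p : baire) : baire := fun i => `[< halts (machine_of i) p >].

Definition halting_problem : baire := jump (fun=> 0).

(* Walks to cell [j.+1] of the input tape; halts there iff it does not scan
   the symbol 2. *)
Definition probe (j : nat) : machine :=
  rcons [seq Quadruple q Input b (MoveRight Input) q.+1
        | q <- iota 0 j.+1, b <- iota 0 3]
    (Quadruple j.+1 Input 2 (Emit 0) j.+1).

Lemma word_symbol p n x : x \in word p n -> x = 1 \/ x = 2.
Proof.
case/flattenP=> s /mapP[i _ ->]; rewrite mem_rcons inE => /orP[/eqP|]; first by right.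
by rewrite mem_nseq => /andP[_ /eqP]; left.
Qed.

Lemma wordS p n : word p n.+1 = word p n ++ rcons (nseq (p n) 1) 2.
Proof. by rewrite /word -(addn1 n) iotaD map_cat flatten_cat /= cats0 add0n. Qed.

Lemma size_word p n : n <= size (word p n).
Proof.
elim: n => // n IHn.
by rewrite wordS size_cat size_rcons size_nseq addnS ltnS (leq_trans IHn) ?leq_addr.
Qed.

Lemma word_prefix p m n : m <= n -> prefix (word p m) (word p n).
Proof.
move=> /subnKC <-; elim: (n - m) => [|d IHd]; first by rewrite addn0 prefix_refl.
by rewrite addnS wordS; apply: prefix_trans IHd (prefix_prefix _ _).
Qed.

Lemma input_symbolE p n j :
  j < size (word p n) -> input_symbol p j.+1 = nth 0 (word p n) j.
Proof.
move=> ltj; have lt1 := size_word p j.+1; rewrite /input_symbol.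
have [le|/ltnW le] := leqP j.+1 n.
  by have /prefixP[s ->] := word_prefix p le; rewrite [RHS]nth_cat lt1.
by have /prefixP[s ->] := word_prefix p le; rewrite [LHS]nth_cat ltj.
Qed.

Lemma input_symbol12 p j : input_symbol p j.+1 = 1 \/ input_symbol p j.+1 = 2.
Proof. by apply: (@word_symbol p j.+1); apply/mem_nth/size_word. Qed.

Lemma input_symbol_inj p p' :
  (forall j, input_symbol p j.+1 = input_symbol p' j.+1) -> p = p'.
Proof.
move=> eqs; apply/funext=> n.
have [m] := ubnP n; elim: m n => // m IHm n; rewrite ltnS => le_nm.
have eqw : word p n = word p' n.
  rewrite /word; congr flatten; apply/eq_in_map=> i.
  rewrite mem_iota /= => lt_in.
  by rewrite IHm // (leq_trans lt_in).
wlog lt: p p' eqs eqw {IHm} / p n < p' n => [gen|].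
  case: (ltngtP (p n) (p' n)) => [lt|lt|//]; first exact: gen.
  by symmetry; apply: gen => // j; rewrite eqs.
have := eqs (size (word p n) + p n).
rewrite !(@input_symbolE _ n.+1) ?wordS ?size_cat ?size_rcons ?size_nseq.
- rewrite -eqw !nth_cat !ltnNge !leq_addr /= addKn !nth_rcons !size_nseq.
  by rewrite ltnn eqxx lt nth_nseq lt.
- by rewrite -eqw addnS ltnS leq_add2l ltnW.
- by rewrite addnS.
Qed.

Lemma probe_run j p i : i <= j.+1 ->
  run (probe j) p i = Config i i (fun=> ([::], [::])) [::].
Proof.
elim: i => // i IHi lt_ij; rewrite /run iterS -/(run _ _ _) IHi 1?ltnW // /step.
set c := Config _ _ _ _.
have : has (applicable p c) (probe j).
  apply/hasP; exists (Quadruple i Input (input_symbol p i) (MoveRight Input) i.+1);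
    last by rewrite /applicable /= !eqxx.
  rewrite mem_rcons inE; apply/orP; right; apply/allpairsP.
  exists (i, input_symbol p i); split; [by rewrite mem_iota | | by []].
  by case: (i) => [//|k]; case: (input_symbol12 p k) => /= ->.
rewrite has_filter; case E: [seq _ <- _ | _] => [//|r s] _.
have : r \in [seq r <- probe j | applicable p c r] by rewrite E mem_head.
rewrite mem_filter => /andP[/andP[/eqP st _]].
rewrite mem_rcons inE => /orP[/eqP req|/allpairsP[[q b] [_ _ req]]].
  by move: st lt_ij; rewrite req /= => ->; rewrite ltnn.
by move: st; rewrite req /= => ->.
Qed.

Lemma probe_halts j p : halts (probe j) p <-> input_symbol p j.+1 = 1.
Proof.
set c := run (probe j) p j.+1.
have cE : c = Config j.+1 j.+1 (fun=> ([::], [::])) [::] by apply: probe_run.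
have app i h w o r : j.+1 <= i -> r \in probe j ->
    applicable p (Config i h w o) r -> r = Quadruple j.+1 Input 2 (Emit 0) j.+1.
  move=> le_ji + /andP[/eqP st _].
  rewrite mem_rcons inE => /orP[/eqP//|/allpairsP[[q b] [qj _ req]]].
  move: qj; rewrite mem_iota add0n => /andP[_].
  by move: st; rewrite req /= => ->; rewrite ltnNge le_ji.
split=> [[t]|sym1]; last first.
  exists j.+1; rewrite /halted -/c; apply/hasPn=> r rM; apply/negP=> ar.
  move: (ar); rewrite cE => /app req; move: ar.
  by rewrite (req (leqnn _) rM) /applicable cE [read _ _ _]sym1 andbF.
case: (input_symbol12 p j) => [//|sym2].
have loop d : exists o, run (probe j) p (j.+1 + d) =
    Config j.+1 j.+1 (fun=> ([::], [::])) o.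
  elim: d => [|d [o IHd]]; first by exists [::]; rewrite addn0.
  exists (rcons o 0); rewrite addnS /run iterS -/(run _ _ _) IHd /step.
  set c' := Config _ _ _ _.
  have : has (applicable p c') (probe j).
    apply/hasP; exists (Quadruple j.+1 Input 2 (Emit 0) j.+1).
      by rewrite mem_rcons mem_head.
    by rewrite /applicable [read _ _ _]sym2 /= !eqxx.
  rewrite has_filter; case E: [seq _ <- _ | _] => [//|r s] _.
  have : r \in [seq r <- probe j | applicable p c' r] by rewrite E mem_head.
  by rewrite mem_filter => /andP[ar rM]; rewrite (app _ _ _ _ _ _ rM ar).
case/negP; apply/hasP.
have [le_tj|/ltnW le_jt] := leqP t j.+1; last first.
  have [o] := loop (t - j.+1); rewrite subnKC // => ->.
  exists (Quadruple j.+1 Input 2 (Emit 0) j.+1); first by rewrite mem_rcons mem_head.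
  by rewrite /applicable [read _ _ _]sym2 /= !eqxx.
rewrite probe_run //; case: (ltngtP t j.+1) le_tj => // [lt_tj|->] _; last first.
  exists (Quadruple j.+1 Input 2 (Emit 0) j.+1); first by rewrite mem_rcons mem_head.
  by rewrite /applicable [read _ _ _]sym2 /= !eqxx.
exists (Quadruple t Input (input_symbol p t) (MoveRight Input) t.+1);
  last by rewrite /applicable /= !eqxx.
rewrite mem_rcons inE; apply/orP; right; apply/allpairsP.
exists (t, input_symbol p t); split; [by rewrite mem_iota | | by []].
by case: (t) => [//|i]; case: (input_symbol12 p i) => /= ->.
Qed.

Lemma jump_inj : injective jump.
Proof.
move=> p p' eqJ; apply: input_symbol_inj => j.
have /(congr1 (fun q => q (code_machine (probe j)))) := eqJ.
rewrite /jump code_machineK => eqh.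
have {}eqh : `[< halts (probe j) p >] = `[< halts (probe j) p' >].
  by case: `[< _ >] `[< _ >] eqh => [] [].
have {eqh} : input_symbol p j.+1 = 1 <-> input_symbol p' j.+1 = 1.
  by rewrite -!probe_halts; split=> /asboolP; [rewrite eqh|rewrite -eqh] => /asboolP.
by case: (input_symbol12 p j) (input_symbol12 p' j) => -> [] -> // [h1 h2];
  [rewrite h1|rewrite h2].
Qed.

Definition jump_inv : pfun baire baire := pfun_of_rel (fun q p => jump p = q).

Lemma jump_invP q p : jump_inv q = Some p <-> jump p = q.
Proof. by apply: pfun_of_relP => {}q {}p p' <- /jump_inj. Qed.

(* Convergence is with respect to the product topology on nat -> nat, the
   factors being discrete. *)
Definition lim_baire : pfun baire baire := pfun_of_rel
  (fun p q => (column p : nat -> {ptws nat -> nat}) @ \oo --> (q : {ptws nat -> nat})).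

Lemma lim_baireP p q : lim_baire p = Some q <->
  (column p : nat -> {ptws nat -> nat}) @ \oo --> (q : {ptws nat -> nat}).
Proof.
apply: pfun_of_relP => {}p {}q q'; apply: cvg_unique.
by apply: hausdorff_product => _; apply: discrete_hausdorff.
Qed.

Definition low_map : pfun baire baire := pcomp jump_inv lim_baire.

Definition computable (F : pfun baire baire) : Prop :=
  exists M, forall p q, F p = Some q -> produces M p q.

Definition computable_rel (q : baire) (F : pfun baire baire) : Prop :=
  exists2 G, computable G & forall p, pdom F p -> F p = G (join_baire q p).

Definition low (F : pfun baire baire) : Prop :=
  exists2 G, computable G & F = pcomp low_map G.

Record rep_space := RepSpace {
  carrier :> Type;
  repr : pfun baire carrier;
  repr_surj : psurjective repr }.

Lemma psurjective_comp A B C (G : pfun B C) (F : pfun A B) :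
  psurjective G -> psurjective F -> psurjective (pcomp G F).
Proof.
move=> Gs Fs c; have [b Gb] := Gs c; have [a Fa] := Fs b.
by exists a; rewrite /pcomp Fa.
Qed.

Lemma jump_inv_surj : psurjective jump_inv.
Proof. by move=> p; exists (jump p); apply/jump_invP. Qed.

Lemma lim_baire_surj : psurjective lim_baire.
Proof.
move=> q; exists (fun c => q (unpair_nat c).2); apply/lim_baireP.
have -> : column (fun c => q (unpair_nat c).2) = fun=> q.
  by apply/funext=> n; apply/funext=> k; rewrite /column pair_natK.
exact: cvg_cst.
Qed.

Lemma low_map_surj : psurjective low_map.
Proof. exact: psurjective_comp jump_inv_surj lim_baire_surj. Qed.

Definition low_space (X : rep_space) : rep_space :=
  RepSpace (psurjective_comp (@repr_surj X) low_map_surj).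

Definition jump_space (X : rep_space) : rep_space :=
  RepSpace (psurjective_comp (@repr_surj X) jump_inv_surj).


(* [f x] is the set of values of [f] at [x]; it is empty iff [f] is not
   defined at [x]. *)
Definition problem (X Y : rep_space) := X -> set Y.

Definition mdom (X Y : rep_space) (f : problem X Y) : set X :=
  [set x | f x !=set0].

Definition realizer (X Y : rep_space) (F : pfun baire baire)
    (f : problem X Y) : Prop :=
  forall p x, repr X p = Some x -> mdom f x ->
    exists2 y, pcomp (@repr Y) F p = Some y & f x y.

Definition problem_computable (X Y : rep_space) (f : problem X Y) : Prop :=
  exists2 F, computable F & realizer F f.

Definition problem_computable_rel (q : baire) (X Y : rep_space)
    (f : problem X Y) : Prop :=
  exists2 F, computable_rel q F & realizer F f.

Definition problem_low (X Y : rep_space) (f : problem X Y) : Prop :=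
  exists2 F, low F & realizer F f.

(* Main.v *)
From mathcomp Require Import all_boot.
From mathcomp Require Import boolp classical_sets topology zify.
Require Import Defs.

(** (1) and (2) are the same by unfolding.  If [G] is computable then [lim G(p)]
    is computable from the jump [J(p)]: [v] is the limit of [G(p)<n,k>] as soon
    as, for some [N], the machine that searches for an [n >= N] with
    [G(p)<n,k> <> v] does not halt on [p].  This gives (2) => (4).  Conversely a
    computable [K] lifts to sequences: running [K] for [n] steps on the [n]-th
    member of a sequence yields a sequence converging to [K] of the limit.  As
    [J(p)], and even [<0', J(p)>], is the limit of a sequence computable from [p],
    the remaining implications follow by composition.

    Computability is reduced to primitive recursive functions on codes of finite
    words: a machine run on an initial segment of [p] for as many steps as the
    segment is long does not notice that it is cut off, and a function with such
    approximations is computed by a machine that reads [p] number by number. *)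

Set Implicit Arguments.
Unset Strict Implicit.
Unset Printing Implicit Defensive.

(** * Programs with registers, and their compilation to machines *)

(** The jump refers to one fixed numbering of machines. A question about [p] can be put to [jump p]
    only if the index of a machine that asks it is computable from the parameters of the question:
    an s-m-n theorem for concrete machines. This is why a stream machine carries its parameter in
    the length of a chain of states, and why machines themselves are among the coded types. In the
    other direction, from machines to functions on words, the number of simulated steps is always
    known in advance, so bounded iteration suffices; unbounded search occurs only in the main loop
    of a stream machine.

    Partiality is confined to the passage from words to points: functions on words are total, and
    only their behaviour along segments of points of the domain is constrained. Compositions are
    formed from approximations, never from machines.

    The oracle in (5) adds no power because the halting problem is the jump of a fixed computable
    point. It is approximated by the same stages as [jump p], and interleaving preserves limits. *)

Inductive command :=
  | Skip
  | Incr of nat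
  | Print of nat
  | Fetch of nat
  | Then of command & command
  | Cond of nat & command & command
  | Loop of nat & command.

Definition store := nat -> nat.

Definition update (s : store) r v : store := fun j => if j == r then v else s j.

(** Big-step semantics speaks of terminating runs only; the endless main loop of a stream machine is
    followed round by round, by [compile_loop_step]. A successful test in [Cond] or [Loop] also
    decrements, because the machine that finds a one stands on the very cell to be erased. *)
Inductive exec (p : baire) :
    command -> store * nat * seq nat -> store * nat * seq nat -> Prop :=
  | ExecSkip x : exec p Skip x x
  | ExecIncr r s i o : exec p (Incr r) (s, i, o) (update s r (s r).+1, i, o)
  | ExecPrint b s i o : exec p (Print b) (s, i, o) (s, i, rcons o b)
  | ExecFetch r s i o :
      exec p (Fetch r) (s, i, o) (update s r (s r + p i), i.+1, o)
  | ExecThen c1 c2 x y z :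
      exec p c1 x y -> exec p c2 y z -> exec p (Then c1 c2) x z
  | ExecCondS r c1 c2 s i o n y : s r = n.+1 ->
      exec p c1 (update s r n, i, o) y -> exec p (Cond r c1 c2) (s, i, o) y
  | ExecCond0 r c1 c2 s i o y : s r = 0 ->
      exec p c2 (s, i, o) y -> exec p (Cond r c1 c2) (s, i, o) y
  | ExecLoopS r c s i o n y z : s r = n.+1 ->
      exec p c (update s r n, i, o) y -> exec p (Loop r c) y z ->
      exec p (Loop r c) (s, i, o) z
  | ExecLoop0 r c s i o : s r = 0 -> exec p (Loop r c) (s, i, o) (s, i, o).

Fixpoint fresh_states (c : command) : nat :=
  match c with
  | Skip | Incr _ | Print _ => 0
  | Fetch _ => 3
  | Then c1 c2 => (fresh_states c1 + fresh_states c2).+1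
  | Cond _ c1 c2 => (fresh_states c1 + fresh_states c2).+3
  | Loop _ c => (fresh_states c).+2
  end.

(* The program starts in state [s], ends in state [t], and uses the states from
   [n] to [n + fresh_states c - 1] in between.
   Register [r] is stored in unary on work tape [r], with the head on the blank
   cell to the right of the ones.  Hence writing 0 does nothing. *)
Fixpoint compile (c : command) (s t n : nat) : machine :=
  match c with
  | Skip => [:: Quadruple s (Work 0) 0 (Write 0 0) t]
  | Incr r => [:: Quadruple s (Work r) 0 (Write r 1) s;
                  Quadruple s (Work r) 1 (MoveRight (Work r)) t]
  | Print b => [:: Quadruple s (Work 0) 0 (Emit b) t]
  | Fetch r => [:: Quadruple s Input 0 (MoveRight Input) n;
                   Quadruple s Input 2 (MoveRight Input) n;
                   Quadruple n Input 2 (Write r 0) t;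
                   Quadruple n Input 1 (Write r 1) n.+1;
                   Quadruple n.+1 (Work r) 1 (MoveRight (Work r)) n.+2;
                   Quadruple n.+2 Input 1 (MoveRight Input) n]
  | Then c1 c2 => compile c1 s n n.+1 ++ compile c2 n t (n.+1 + fresh_states c1)
  | Cond r c1 c2 =>
      [:: Quadruple s (Work r) 0 (MoveLeft (Work r)) n;
          Quadruple n (Work r) 1 (Write r 0) n.+1;
          Quadruple n (Work r) 0 (MoveRight (Work r)) n.+2]
      ++ compile c1 n.+1 t n.+3 ++ compile c2 n.+2 t (n.+3 + fresh_states c1)
  | Loop r c =>
      [:: Quadruple s (Work r) 0 (MoveLeft (Work r)) n;
          Quadruple n (Work r) 1 (Write r 0) n.+1;
          Quadruple n (Work r) 0 (MoveRight (Work r)) t]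
      ++ compile c n.+1 s n.+2
  end.

(** [step] fires the first applicable quadruple. Under this condition the order of the list is
    irrelevant, so a compiled fragment works in every deterministic machine that contains its
    quadruples. *)
Definition deterministic (M : machine) := forall q1 q2, q1 \in M -> q2 \in M ->
  state q1 = state q2 ->
  scan q1 = scan q2 /\ (symbol q1 = symbol q2 -> q1 = q2).

Lemma compile_state c s t n q : q \in compile c s t n ->
  state q = s \/ n <= state q < n + fresh_states c.
Proof.
elim: c s t n => [|r|b|r|c1 IH1 c2 IH2|r c1 IH1 c2 IH2|r c IH] s t n /=.
- by rewrite inE => /eqP->; left.
- by rewrite !inE => /orP[]/eqP->; left.
- by rewrite inE => /eqP->; left.
- by rewrite !inE; do ![case/orP]=> /eqP-> /=; lia.
- by rewrite mem_cat => /orP[/IH1|/IH2]; lia.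
- rewrite -[_ :: _]/([:: _; _; _] ++ _) !mem_cat => /or3P[|/IH1|/IH2]; [|lia..].
  by rewrite !inE; do ![case/orP]=> /eqP-> /=; lia.
- rewrite -[_ :: _]/([:: _; _; _] ++ _) mem_cat => /orP[|/IH]; last lia.
  by rewrite !inE; do ![case/orP]=> /eqP-> /=; lia.
Qed.

Lemma deterministic_cat M1 M2 : deterministic M1 -> deterministic M2 ->
  (forall q1 q2, q1 \in M1 -> q2 \in M2 -> state q1 <> state q2) ->
  deterministic (M1 ++ M2).
Proof.
move=> d1 d2 d12 q1 q2; rewrite !mem_cat.
move=> /orP[m1|m1] /orP[m2|m2] eqs; [exact: d1|by case: (d12 q1 q2)| |exact: d2].
by case: (d12 q2 q1).
Qed.

Lemma deterministic_compile c s t n : (s < n) || (n + fresh_states c <= s) ->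
  deterministic (compile c s t n).
Proof.
elim: c s t n => [|r|b|r|c1 IH1 c2 IH2|r c1 IH1 c2 IH2|r c IH] s t n hs.
- by move=> q1 q2; rewrite !inE => /eqP-> /eqP->.
- by move=> q1 q2; rewrite !inE => /orP[]/eqP-> /orP[]/eqP->.
- by move=> q1 q2; rewrite !inE => /eqP-> /eqP->.
- move: hs => /= hs q1 q2; rewrite !inE.
  by do ![case/orP]=> /eqP->; do ![case/orP]=> /eqP-> //=; lia.
- rewrite /= in hs *; apply: deterministic_cat => [||q1 q2].
  + by apply: IH1; lia.
  + by apply: IH2; lia.
  + by move=> /compile_state h1 /compile_state h2; lia.
- rewrite /= in hs *; rewrite -[_ :: _]/([:: _; _; _] ++ _).
  apply: deterministic_cat => [q1 q2||q1 q2].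
  + rewrite !inE.
    by do ![case/orP]=> /eqP->; do ![case/orP]=> /eqP-> //=; lia.
  + apply: deterministic_cat => [||q1 q2].
    * by apply: IH1; lia.
    * by apply: IH2; lia.
    * by move=> /compile_state h1 /compile_state h2; lia.
  + rewrite mem_cat => h /orP[]/compile_state;
    by move: h; rewrite !inE; do ![case/orP]=> /eqP->/=; lia.
- rewrite /= in hs *; rewrite -[_ :: _]/([:: _; _; _] ++ _).
  apply: deterministic_cat => [q1 q2||q1 q2].
  + rewrite !inE.
    by do ![case/orP]=> /eqP->; do ![case/orP]=> /eqP-> //=; lia.
  + by apply: IH; lia.
  + by rewrite !inE => h /compile_state; move: h; do ![case/orP]=> /eqP->/=; lia.
Qed.

(** [a] and [b] count blank cells that have been visited and therefore occur explicitly in the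
    lists; the representation of a tape is not unique. *)
Definition tape_holds (v : nat) (t : tape) : Prop :=
  exists a b, t = (nseq v 1 ++ nseq a 0, nseq b 0).

(** The input head rests on the last cell of what has been fetched: cell 0 at the start, afterwards
    the symbol 2 that ends the last fetched number. *)
Definition holds (p : baire) (x : store * nat * seq nat) (q : nat) (c : config) :=
  exists2 w, c = Config q (size (word p x.1.2)) w x.2 &
    forall r, tape_holds (x.1.1 r) (w r).

Lemma tape_holds_read v t : tape_holds v t -> tape_read t = 0.
Proof. by case=> a [b ->]; case: b. Qed.

Lemma tape_holds_write0 v t : tape_holds v t -> tape_holds v (tape_write 0 t).
Proof. by case=> a [b ->]; exists a, b.-1.+1; case: b. Qed.

Lemma tape_holds_incr v t : tape_holds v t ->
  tape_holds v.+1 (tape_right (tape_write 1 t)).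
Proof. by case=> a [b ->]; exists a, b.-1; case: b. Qed.

Lemma tape_holds_left0 t : tape_holds 0 t -> tape_read (tape_left t) = 0 /\
  tape_holds 0 (tape_right (tape_left t)).
Proof.
case=> a [b ->]; split; first by case: a.
by exists a.-1.+1, b; case: a.
Qed.

Lemma tape_holds_leftS v t : tape_holds v.+1 t -> tape_read (tape_left t) = 1 /\
  tape_holds v (tape_write 0 (tape_left t)).
Proof. by case=> a [b ->]; split=> //; exists a, b.+1. Qed.

Lemma tape_holds_update (s : store) (w : nat -> tape) r v t :
  (forall j, tape_holds (s j) (w j)) -> tape_holds v t ->
  forall j, tape_holds (update s r v j) (set_work w r t j).
Proof. by move=> hw ht j; rewrite /update /set_work; case: eqP. Qed.

Lemma updateE s r v : update s r v r = v.
Proof. by rewrite /update eqxx. Qed.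

Lemma set_workE w r t : set_work w r t r = t.
Proof. by rewrite /set_work eqxx. Qed.

Lemma step_deterministic M p c r : deterministic M -> r \in M ->
  applicable p c r -> step M p c = perform (act r) (next r) c.
Proof.
move=> dM rM ar; rewrite /step.
have : has (applicable p c) M by apply/hasP; exists r.
rewrite has_filter; case E: [seq _ <- _ | _] => [//|r' s] _.
have : r' \in [seq r <- M | applicable p c r] by rewrite E mem_head.
rewrite mem_filter => /andP[/andP[/eqP st' /eqP sy'] rM'].
move: ar => /andP[/eqP st /eqP sy].
have [|sc /(_ _)->//] := dM r' r rM' rM; first by rewrite st st'.
by rewrite sy sy' sc.
Qed.

(** At least one step is counted, so that every round of the main loop costs time; this yields
    [n <= t] in [stream_run]. *)
Definition reaches M p c c' := exists n, iter n.+1 (step M p) c = c'.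

Lemma reaches_trans M p c1 c2 c3 :
  reaches M p c1 c2 -> reaches M p c2 c3 -> reaches M p c1 c3.
Proof. by move=> [m <-] [n <-]; exists (n + m.+1); rewrite -iterD addSn. Qed.

Lemma reaches_step M p q t b a q' c : deterministic M ->
  Quadruple q t b a q' \in M -> cstate c = q -> read p c t = b ->
  reaches M p c (perform a q' c).
Proof.
move=> dM rM cq rb; exists 0.
by rewrite /= (step_deterministic dM rM) // /applicable /= cq rb !eqxx.
Qed.

Lemma set_work2 w r t1 t2 : set_work (set_work w r t1) r t2 = set_work w r t2.
Proof. by apply/funext=> j; rewrite /set_work; case: eqP. Qed.

Lemma input_symbol_mark p i : input_symbol p (size (word p i)) = if i is 0 then 0 else 2.
Proof.
case: i => [//|i]; rewrite wordS size_cat size_rcons addnS.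
rewrite (@input_symbolE _ i.+1) wordS ?size_cat ?size_rcons ?addnS //.
by rewrite nth_cat ltnNge leq_addr addKn nth_rcons ltnn eqxx.
Qed.

Lemma input_symbol_number p i j : j <= p i ->
  input_symbol p (size (word p i) + j).+1 = if j < p i then 1 else 2.
Proof.
move=> le_j; rewrite (@input_symbolE _ i.+1) wordS ?size_cat ?size_rcons; last first.
  by rewrite size_nseq; lia.
rewrite nth_cat ltnNge leq_addr addKn nth_rcons size_nseq nth_nseq.
by case: (ltngtP j (p i)) le_j.
Qed.

Lemma holds_increment M p q q' r s w v h o : deterministic M ->
  Quadruple q (Work r) 1 (MoveRight (Work r)) q' \in M ->
  (forall j, tape_holds (s j) (w j)) -> tape_holds v (w r) ->
  exists2 w', reaches M p (Config q h (set_work w r (tape_write 1 (w r))) o)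
                          (Config q' h w' o)
    & forall j, tape_holds (update s r v.+1 j) (w' j).
Proof.
move=> dM qM hw hv; exists (set_work w r (tape_right (tape_write 1 (w r)))).
  have := reaches_step (c := Config q h (set_work w r (tape_write 1 (w r))) o) (p := p) dM qM.
  by rewrite /= set_work2 set_workE; apply.
by apply: tape_holds_update => //; apply: tape_holds_incr.
Qed.

(* These are the quadruples with which [Cond] and [Loop] begin. *)
Lemma holds_decrement M p s n q1 q0 r sto w h o : deterministic M ->
  {subset [:: Quadruple s (Work r) 0 (MoveLeft (Work r)) n;
              Quadruple n (Work r) 1 (Write r 0) q1;
              Quadruple n (Work r) 0 (MoveRight (Work r)) q0] <= M} ->
  (forall j, tape_holds (sto j) (w j)) ->
  exists2 w', reaches M p (Config s h w o)
                (Config (if sto r is _.+1 then q1 else q0) h w' o)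
    & forall j, tape_holds (update sto r (sto r).-1 j) (w' j).
Proof.
move=> dM sub hw.
have [m1 m2 m3] : [/\ Quadruple s (Work r) 0 (MoveLeft (Work r)) n \in M,
    Quadruple n (Work r) 1 (Write r 0) q1 \in M
    & Quadruple n (Work r) 0 (MoveRight (Work r)) q0 \in M].
  by split; apply: sub; rewrite !inE eqxx ?orbT.
have := reaches_step (c := Config s h w o) (p := p) dM m1 erefl (tape_holds_read (hw r)).
move=> /= r1; have hr := hw r; case E: (sto r) hr => [|v] hr.
  have [rd hr'] := tape_holds_left0 hr.
  exists (set_work w r (tape_right (tape_left (w r)))).
    apply: reaches_trans r1 _.
    have := reaches_step (c := Config n h (set_work w r (tape_left (w r))) o) (p := p) dM m3 erefl.
    by rewrite /= set_work2 set_workE; apply.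
  by apply: tape_holds_update.
have [rd hr'] := tape_holds_leftS hr.
exists (set_work w r (tape_write 0 (tape_left (w r)))).
  apply: reaches_trans r1 _.
  have := reaches_step (c := Config n h (set_work w r (tape_left (w r))) o) (p := p) dM m2 erefl.
  by rewrite /= set_work2 set_workE; apply.
by apply: tape_holds_update.
Qed.

Lemma compile_fetch M p r s t n sto w i o : deterministic M ->
  {subset compile (Fetch r) s t n <= M} -> (forall j, tape_holds (sto j) (w j)) ->
  exists2 w', reaches M p (Config s (size (word p i)) w o)
                          (Config t (size (word p i.+1)) w' o)
    & forall j, tape_holds (update sto r (sto r + p i) j) (w' j).
Proof.
move=> dM /= sub hw; set h := size _.
have [m1 m2 m3 m4] : [/\ Quadruple s Input 0 (MoveRight Input) n \in M,
    Quadruple s Input 2 (MoveRight Input) n \in M,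
    Quadruple n Input 2 (Write r 0) t \in M
    & Quadruple n Input 1 (Write r 1) n.+1 \in M].
  by split; apply: sub; rewrite !inE eqxx ?orbT.
have [m5 m6] : Quadruple n.+1 (Work r) 1 (MoveRight (Work r)) n.+2 \in M /\
    Quadruple n.+2 Input 1 (MoveRight Input) n \in M.
  by split; apply: sub; rewrite !inE eqxx ?orbT.
(* Here [d] ones have been transferred to the work tape, and the input head scans the cell after
   them. *)
have ones d k : d + k = p i -> exists2 w',
    reaches M p (Config s h w o) (Config n (h + d).+1 w' o) &
    forall j, tape_holds (update sto r (sto r + d) j) (w' j).
  elim: d k => [|d IHd] k dk.
    exists w; last first.
      by move=> j; rewrite addn0 /update; case: eqP => [->|].
    have := input_symbol_mark p i; rewrite -/h addn0; case: (i) => [|i'] sym.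
      exact: (reaches_step (c := Config s h w o) dM m1 erefl sym).
    exact: (reaches_step (c := Config s h w o) dM m2 erefl sym).
  have [w' rw' hw'] : exists2 w',
      reaches M p (Config s h w o) (Config n (h + d).+1 w' o) &
      forall j, tape_holds (update sto r (sto r + d) j) (w' j).
    by apply: (IHd k.+1); rewrite addnS.
  have sym1 : input_symbol p (h + d).+1 = 1.
    by rewrite input_symbol_number -?dk ?addSn ?ltnS ?leq_addr //; lia.
  have := hw' r; rewrite updateE => hr.
  have [w'' rw'' hw''] := holds_increment p (h + d).+1 o dM m5 hw' hr.
  exists w''.
    apply: reaches_trans rw' _.
    apply: reaches_trans (reaches_step (c := Config n _ w' o) dM m4 erefl sym1) _.
    apply: reaches_trans rw'' _; rewrite addnS.
    exact: (reaches_step (c := Config n.+2 (h + d).+1 w'' o) dM m6 erefl sym1).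
  by move=> j; have := hw'' j; rewrite /update addnS; case: eqP.
have [w' rw' hw'] := ones (p i) 0 (addn0 _).
have sym2 : input_symbol p (h + p i).+1 = 2 by rewrite input_symbol_number // ltnn.
exists (set_work w' r (tape_write 0 (w' r))).
  apply: reaches_trans rw' _.
  have -> : size (word p i.+1) = (h + p i).+1.
    by rewrite wordS size_cat size_rcons size_nseq addnS.
  exact: (reaches_step (c := Config n _ w' o) dM m3 erefl sym2).
move=> j; have := hw' j; rewrite /set_work; case: eqP => // ->.
exact: tape_holds_write0.
Qed.

(** The body enters as a statement about configurations instead of an [exec] derivation, and only
    one round is treated. Hence this serves terminating loops as well as the endless loop of
    [stream_run]. *)
Lemma compile_loop_step M p r c s t n sto i o v y : deterministic M ->
  {subset compile (Loop r c) s t n <= M} -> sto r = v.+1 ->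
  (forall cf, holds p (update sto r v, i, o) n.+1 cf ->
    exists2 cf', reaches M p cf cf' & holds p y s cf') ->
  forall cf, holds p (sto, i, o) s cf ->
  exists2 cf', reaches M p cf cf' & holds p y s cf'.
Proof.
move=> dM /= sub E body _ [/= w -> hw].
have [|w' rw' hw'] := holds_decrement (r := r) (s := s) (n := n) (q1 := n.+1) (q0 := t)
    p (size (word p i)) o dM _ hw.
  by move=> q qc; apply: sub; rewrite -[_ :: _]/([:: _; _; _] ++ _) mem_cat qc.
move: rw' hw'; rewrite E /= => rw' hw'.
have [|cf r1 h1] := body (Config n.+1 (size (word p i)) w' o); first by exists w'.
by exists cf => //; apply: reaches_trans rw' r1.
Qed.

Theorem compile_correct M p c x y s t n cf : deterministic M ->
  {subset compile c s t n <= M} -> exec p c x y -> holds p x s cf ->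
  exists2 cf', reaches M p cf cf' & holds p y t cf'.
Proof.
move=> dM sub e; elim: e s t n cf sub => {c x y}.
- move=> [[sto i] o] s t n cf sub [/= w -> hw].
  exists (Config t (size (word p i)) (set_work w 0 (tape_write 0 (w 0))) o).
    have m : Quadruple s (Work 0) 0 (Write 0 0) t \in M by apply: sub; rewrite mem_head.
    exact: (reaches_step (c := Config s _ w o) dM m erefl (tape_holds_read (hw 0))).
  by exists (set_work w 0 (tape_write 0 (w 0))) => // j; rewrite /set_work;
    case: eqP => [->|//]; apply: tape_holds_write0.
- move=> r sto i o s t n cf sub [/= w -> hw].
  have [m1 m2] : Quadruple s (Work r) 0 (Write r 1) s \in M /\
      Quadruple s (Work r) 1 (MoveRight (Work r)) t \in M.
    by split; apply: sub; rewrite !inE eqxx ?orbT.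
  have [w' rw' hw'] := holds_increment p (size (word p i)) o dM m2 hw (hw r).
  exists (Config t (size (word p i)) w' o); last by exists w'.
  apply: reaches_trans rw'.
  exact: (reaches_step (c := Config s _ w o) dM m1 erefl (tape_holds_read (hw r))).
- move=> b sto i o s t n cf sub [/= w -> hw].
  exists (Config t (size (word p i)) w (rcons o b)); last by exists w.
  have m : Quadruple s (Work 0) 0 (Emit b) t \in M by apply: sub; rewrite mem_head.
  exact: (reaches_step (c := Config s _ w o) dM m erefl (tape_holds_read (hw 0))).
- move=> r sto i o s t n cf sub [/= w -> hw].
  have [w' rw' hw'] := compile_fetch p i o dM sub hw.
  by exists (Config t (size (word p i.+1)) w' o) => //; exists w'.
- move=> c1 c2 x y z _ IH1 _ IH2 s t n cf sub hx.
  have [|cf1 r1 h1] := IH1 s n n.+1 cf _ hx.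
    by move=> q qc; apply: sub; rewrite mem_cat qc.
  have [|cf2 r2 h2] := IH2 n t (n.+1 + fresh_states c1) cf1 _ h1.
    by move=> q qc; apply: sub; rewrite mem_cat qc orbT.
  by exists cf2 => //; apply: reaches_trans r1 r2.
- move=> r c1 c2 sto i o v y E _ IH s t n cf; rewrite /= => sub [/= w -> hw].
  have [|w' rw' hw'] := holds_decrement (r := r) (s := s) (n := n) (q1 := n.+1)
      (q0 := n.+2) p (size (word p i)) o dM _ hw.
    by move=> q qc; apply: sub; rewrite -[_ :: _]/([:: _; _; _] ++ _) mem_cat qc.
  move: rw' hw'; rewrite E /= => rw' hw'.
  have [||cf2 r2 h2] := IH n.+1 t n.+3 (Config n.+1 (size (word p i)) w' o).
    move=> q qc; apply: sub.
    by rewrite -[_ :: _]/([:: _; _; _] ++ _) !mem_cat qc orbT.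
    by exists w'.
  by exists cf2 => //; apply: reaches_trans rw' r2.
- move=> r c1 c2 sto i o y E _ IH s t n cf; rewrite /= => sub [/= w -> hw].
  have [|w' rw' hw'] := holds_decrement (r := r) (s := s) (n := n) (q1 := n.+1)
      (q0 := n.+2) p (size (word p i)) o dM _ hw.
    by move=> q qc; apply: sub; rewrite -[_ :: _]/([:: _; _; _] ++ _) mem_cat qc.
  move: rw' hw'; rewrite E /= => rw' hw'.
  have [||cf2 r2 h2] := IH n.+2 t (n.+3 + fresh_states c1) (Config n.+2 (size (word p i)) w' o).
    move=> q qc; apply: sub.
    by rewrite -[_ :: _]/([:: _; _; _] ++ _) !mem_cat qc !orbT.
    by exists w' => // j; have := hw' j; rewrite /update; case: eqP => //= ->; rewrite E.
  by exists cf2 => //; apply: reaches_trans rw' r2.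
- move=> r c sto i o v y z E _ IH1 _ IH2 s t n cf sub hx.
  have [|cf1 r1 h1] := compile_loop_step (y := y) dM sub E _ hx.
    move=> cf1; apply: (IH1 _ _ n.+2) => q qc; apply: sub.
    by rewrite /= -[_ :: _]/([:: _; _; _] ++ _) mem_cat qc orbT.
  have [cf2 r2 h2] := IH2 s t n cf1 sub h1.
  by exists cf2 => //; apply: reaches_trans r1 r2.
- move=> r c sto i o E s t n cf; rewrite /= => sub [/= w -> hw].
  have [|w' rw' hw'] := holds_decrement (r := r) (s := s) (n := n) (q1 := n.+1)
      (q0 := t) p (size (word p i)) o dM _ hw.
    by move=> q qc; apply: sub; rewrite -[_ :: _]/([:: _; _; _] ++ _) mem_cat qc.
  move: rw' hw'; rewrite E /= => rw' hw'.
  exists (Config t (size (word p i)) w' o) => //; exists w' => // j.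
  by have := hw' j; rewrite /update; case: eqP => //= ->; rewrite E.
Qed.

(** * Primitive recursive functions *)

Lemma unpair_natK c : pair_nat (unpair_nat c).1 (unpair_nat c).2 = c.
Proof.
elim: c => //= c; case: (unpair_nat c) => [[|n] k] /= IHc.
  by rewrite pair_natS0 IHc.
by rewrite pair_natSS IHc.
Qed.

Lemma unpair_nat_le c : (unpair_nat c).1 <= c /\ (unpair_nat c).2 <= c.
Proof. by elim: c => //= c; case: (unpair_nat c) => [[|n] k] /=; lia. Qed.

Lemma leq_pair_nat n k : n <= pair_nat n k /\ k <= pair_nat n k.
Proof. by have := unpair_nat_le (pair_nat n k); rewrite pair_natK. Qed.

Lemma pair_nat_add n k : pair_nat n k = pair_nat (n + k) 0 + k.
Proof. by rewrite /pair_nat !addn0. Qed.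

Lemma pair_natS0_add m : pair_nat m.+1 0 = pair_nat m 0 + m.+1.
Proof. by rewrite pair_natS0 pair_nat_add add0n addnS. Qed.

(* Pairing makes up for the lack of functions of several variables. *)
Inductive prec : (nat -> nat) -> Prop :=
  | prec_id : prec id
  | prec_0 : prec (fun=> 0)
  | prec_S : prec S
  | prec_fst : prec (fun c => (unpair_nat c).1)
  | prec_snd : prec (fun c => (unpair_nat c).2)
  | prec_comp f g : prec f -> prec g -> prec (f \o g)
  | prec_pair f g : prec f -> prec g -> prec (fun c => pair_nat (f c) (g c))
  | prec_iter f : prec f ->
      prec (fun c => iter (unpair_nat c).1 f (unpair_nat c).2).

(** All registers beyond [l] are 0. A specification in terms of [regs] thus also says that scratch
    registers start empty and are left empty. *)
Definition regs (s : store) (r : nat) (l : seq nat) : store :=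
  fun j => if j < r then s j else nth 0 l (j - r).

Lemma regs_nth s r l a : regs s r l (r + a) = nth 0 l a.
Proof. by rewrite /regs ltnNge leq_addr addKn. Qed.

Lemma regs_update s r l a v :
  update (regs s r l) (r + a) v = regs s r (set_nth 0 l a v).
Proof.
apply/funext=> j; rewrite /update /regs nth_set_nth /=; case: eqP => [->|ne].
  by rewrite ltnNge leq_addr addKn eqxx.
by case: ltnP => // le; case: eqP => // eq; lia.
Qed.

Lemma regs_cat s r l1 l2 : regs s r (l1 ++ l2) = regs (regs s r l1) (r + size l1) l2.
Proof.
apply/funext=> j; rewrite /regs nth_cat.
case: (ltnP j r) => [lt|le]; first by rewrite (leq_trans lt) ?leq_addr.
have -> : (j - r < size l1) = (j < r + size l1) by lia.
by case: ifP => // _; congr nth; lia.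
Qed.

Lemma regs_cat0 s r l : regs s r (rcons l 0) = regs s r l.
Proof.
apply/funext=> j; rewrite /regs; case: ifP => // _.
by rewrite nth_rcons; case: ltngtP => [||->] //; [move=> ?|]; rewrite nth_default //; lia.
Qed.

Lemma regs_pad s r x : regs s r [:: x; 0; 0] = regs s r [:: x].
Proof. by rewrite -(regs_cat0 _ _ [:: x]) -(regs_cat0 _ _ [:: _; _]). Qed.

Section RegisterPrograms.
Variables (p : baire) (s : store) (r i : nat) (o : seq nat).

Local Notation execr c l l' := (exec p c (regs s r l, i, o) (regs s r l', i, o)).

Lemma exec_incr a l : execr (Incr (r + a)) l (set_nth 0 l a (nth 0 l a).+1).
Proof. by rewrite -regs_update -(regs_nth s r); apply: ExecIncr. Qed.

(* [S k] are the registers when [k] rounds remain. *)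
Lemma exec_loop a c (S : nat -> seq nat) n : (forall k, nth 0 (S k) a = k) ->
  (forall k, k < n -> execr c (set_nth 0 (S k.+1) a k) (S k)) ->
  execr (Loop (r + a) c) (S n) (S 0).
Proof.
move=> Sa; elim: n => [|n IHn] Sc; first by apply: ExecLoop0; rewrite regs_nth.
apply: ExecLoopS (IHn _); first by rewrite regs_nth.
  by rewrite regs_update; apply: Sc.
by move=> k lt; apply: Sc; apply: ltnW.
Qed.

Lemma exec_move a b l : a != b ->
  execr (Loop (r + a) (Incr (r + b))) l
    (set_nth 0 (set_nth 0 l b (nth 0 l b + nth 0 l a)) a 0).
Proof.
move=> ab; move la: (nth 0 l a) => n.
pose S k := set_nth 0 (set_nth 0 l b (nth 0 l b + (n - k))) a k.
have -> : regs s r l = regs s r (S n).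
  rewrite /S -!regs_update subnn addn0; apply/funext=> j; rewrite /update.
  case: eqP => [->|_]; first by rewrite regs_nth la.
  by case: eqP => [->|_]; rewrite ?regs_nth.
rewrite -{2}(subn0 n); apply: (@exec_loop _ _ S) => [k|k lt].
  by rewrite nth_set_nth /= eqxx.
have := exec_incr b (set_nth 0 (S k.+1) a k).
have -> : nth 0 (set_nth 0 (S k.+1) a k) b = nth 0 l b + (n - k.+1).
  by rewrite !nth_set_nth /= eq_sym (negPf ab) nth_set_nth /= eq_sym (negPf ab) nth_set_nth /= eqxx.
rewrite /S -!regs_update.
have -> : (nth 0 l b + (n - k.+1)).+1 = nth 0 l b + (n - k) by lia.
set s1 := update _ (r + b) (_ + (n - k)); set s2 := (X in _ -> exec _ _ _ (X, _, _)).
have -> // : s1 = s2.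
by apply/funext=> j; rewrite /s1 /s2 /update; do ![case: eqP => ?]; lia.
Qed.

Lemma exec_clear a l : execr (Loop (r + a) Skip) l (set_nth 0 l a 0).
Proof.
have -> : regs s r l = regs s r (set_nth 0 l a (nth 0 l a)).
  rewrite -regs_update; apply/funext=> j; rewrite /update.
  by case: eqP => [->|//]; rewrite regs_nth.
apply: (@exec_loop a Skip (fun k => set_nth 0 l a k)) => [k|k _].
  by rewrite nth_set_nth /= eqxx.
rewrite set_set_nth eqxx; exact: ExecSkip.
Qed.

(** Follows the recursion of [unpair_nat]: each of the [c] rounds goes one step along the current
    antidiagonal or, at its end, to the start of the next one. *)
Definition unpair_program :=
  Loop (r + 0) (Cond (r + 1) (Incr (r + 2))
    (Then (Loop (r + 2) (Incr (r + 1))) (Incr (r + 1)))).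

Lemma exec_unpair c : execr unpair_program [:: c]
  [:: 0; (unpair_nat c).1; (unpair_nat c).2].
Proof.
pose S k := [:: k; (unpair_nat (c - k)).1; (unpair_nat (c - k)).2].
have -> : regs s r [:: c] = regs s r (S c).
  by rewrite /S subnn regs_pad.
rewrite -[c in unpair_nat c]subn0; apply: (@exec_loop 0 _ S) => // k lt.
rewrite /S; have -> : c - k = (c - k.+1).+1 by lia.
rewrite [unpair_nat _.+1]/=; case: (unpair_nat _) => [[|n] m] /=.
  apply: ExecCond0; first by rewrite regs_nth.
  by apply: ExecThen (exec_move _ _) _ => //=; apply: (exec_incr 1).
apply: (@ExecCondS _ _ _ _ _ _ _ n); first by rewrite regs_nth.
by rewrite regs_update; apply: (exec_incr 2).
Qed.

(* The code of a pair is T(n + k) + k for the triangular numbers T. *)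
Definition pair_program :=
  Then (Loop (r + 2) (Then (Incr (r + 0)) (Incr (r + 1))))
    (Loop (r + 1) (Then (Incr (r + 0))
      (Then (Loop (r + 1) (Then (Incr (r + 0)) (Incr (r + 2))))
            (Loop (r + 2) (Incr (r + 1)))))).

Lemma exec_pair n k : execr pair_program [:: 0; n; k] [:: pair_nat n k].
Proof.
rewrite -[in X in exec _ _ _ X]regs_pad.
apply: (@ExecThen _ _ _ _ (regs s r [:: k; n + k; 0], i, o)).
  pose S j := [:: k - j; n + (k - j); j].
  have -> : [:: 0; n; k] = S k by rewrite /S subnn addn0.
  rewrite -[in X in exec _ _ _ X](subn0 k).
  apply: (@exec_loop 2 _ S) => // j lt; rewrite /S /=.
  apply: ExecThen (exec_incr 0 _) _; rewrite /=.
  by rewrite (_ : k - j = (k - j.+1).+1) 1?[n + _.+1]addnS; [apply: (exec_incr 1)|lia].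
have [m] : exists m, m = n + k by eexists.
rewrite pair_nat_add => <-.
(* As [pair_nat j 0] is the triangular number T(j), the round that lowers the counter to [j] adds
   T(j + 1) - T(j) = j + 1. *)
pose S j := [:: k + (pair_nat m 0 - pair_nat j 0); j; 0].
have Tle j : j <= m -> pair_nat j 0 <= pair_nat m 0.
  move=> /subnKC <-; elim: (m - j) => [|d IHd]; first by rewrite addn0.
  by rewrite addnS pair_natS0_add; lia.
have -> : [:: k; m; 0] = S m by rewrite /S subnn addn0.
have -> : [:: pair_nat m 0 + k; 0; 0] = S 0 by rewrite /S subn0 addnC.
apply: (@exec_loop 1 _ S) => // j lt; rewrite /S /=.
have := Tle _ lt; rewrite pair_natS0_add => le.
set x := k + _; have -> : k + (pair_nat m 0 - pair_nat j 0) = x.+1 + j by rewrite /x; lia.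
apply: ExecThen (exec_incr 0 _) _; rewrite /=.
apply: (@ExecThen _ _ _ _ (regs s r [:: x.+1 + j; 0; j], i, o)); last exact: (exec_move (a := 2)).
pose S' h := [:: x.+1 + (j - h); h; j - h].
have -> : [:: x.+1; j; 0] = S' j by rewrite /S' subnn addn0.
rewrite -[in X in exec _ _ _ X](subn0 j).
apply: (@exec_loop 1 _ S') => // h lth; rewrite /S' /=.
apply: ExecThen (exec_incr 0 _) _; rewrite /=.
by rewrite (_ : j - h = (j - h.+1).+1) 1?[x.+1 + _.+1]addnS; [apply: (exec_incr 2)|lia].
Qed.

End RegisterPrograms.

(* [c r] replaces the content [x] of register [r] by [f x], with the registers
   above [r] as scratch space. *)
Definition in_place (f : nat -> nat) (c : nat -> command) :=
  forall p s r i o x,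
  exec p (c r) (regs s r [:: x], i, o) (regs s r [:: f x], i, o).

Lemma exec_in_place f c p s r i o l x : in_place f c ->
  exec p (c (r + size l)) (regs s r (rcons l x), i, o) (regs s r (rcons l (f x)), i, o).
Proof. by move=> cf; rewrite -!cats1 !regs_cat; apply: cf. Qed.

Lemma prec_in_place f : prec f -> exists c, in_place f c.
Proof.
elim=> {f}.
- by exists (fun=> Skip) => p s r i o x; apply: ExecSkip.
- exists (fun r => Loop (r + 0) Skip) => p s r i o x.
  exact: exec_clear _ _ _ _ _ 0 [:: x].
- exists (fun r => Incr (r + 0)) => p s r i o x.
  exact: exec_incr _ _ _ _ _ 0 [:: x].
- exists (fun r => Then (unpair_program r) (Then (Loop (r + 2) Skip)
    (Loop (r + 1) (Incr (r + 0))))) => p s r i o x.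
  rewrite -[in X in exec _ _ _ X]regs_pad.
  apply: ExecThen (exec_unpair _ _ _ _ _ _) _.
  apply: ExecThen (exec_clear _ _ _ _ _ 2 _) _.
  exact: (exec_move _ _ _ _ _ (a := 1) (b := 0)).
- exists (fun r => Then (unpair_program r) (Then (Loop (r + 1) Skip)
    (Loop (r + 2) (Incr (r + 0))))) => p s r i o x.
  rewrite -[in X in exec _ _ _ X]regs_pad.
  apply: ExecThen (exec_unpair _ _ _ _ _ _) _.
  apply: ExecThen (exec_clear _ _ _ _ _ 1 _) _.
  exact: (exec_move _ _ _ _ _ (a := 2) (b := 0)).
- move=> f g _ [cf hf] _ [cg hg]; exists (fun r => Then (cg r) (cf r)) => p s r i o x.
  exact: ExecThen (hg _ _ _ _ _ _) (hf _ _ _ _ _ _).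
- move=> f g _ [cf hf] _ [cg hg].
  (* Of two copies of [x], one is turned into [g x] and the other is then moved above it: a program
     that works in place needs zeros above its register. *)
  exists (fun r => Then (Loop (r + 0) (Then (Incr (r + 1)) (Incr (r + 2))))
    (Then (cg (r + 2)) (Then (Loop (r + 1) (Incr (r + 3))) (Then (cf (r + 3))
      (Then (Loop (r + 3) (Incr (r + 1))) (pair_program r)))))) => p s r i o x.
  apply: (@ExecThen _ _ _ _ (regs s r [:: 0; x; x], i, o)).
    pose S k := [:: k; x - k; x - k].
    have -> : regs s r [:: x] = regs s r (S x).
      by rewrite /S subnn regs_pad.
    rewrite -[in X in exec _ _ _ X](subn0 x).
    apply: (@exec_loop _ _ _ _ _ 0 _ S) => // k lt; rewrite /S /=.
    apply: ExecThen (exec_incr _ _ _ _ _ 1 _) _; rewrite /=.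
    by rewrite (_ : x - k = (x - k.+1).+1); [apply: (exec_incr _ _ _ _ _ 2)|lia].
  apply: ExecThen (exec_in_place _ _ _ _ _ [:: 0; x] x hg) _.
  apply: ExecThen (exec_move _ _ _ _ _ (a := 1) (b := 3) _ _) _ => //=.
  apply: ExecThen (exec_in_place _ _ _ _ _ [:: 0; 0; g x] x hf) _.
  apply: ExecThen (exec_move _ _ _ _ _ (a := 3) (b := 1) _ _) _ => //=.
  rewrite -[[:: 0; _; _; _]]/(rcons [:: 0; f x; g x] 0) regs_cat0.
  exact: exec_pair.
- move=> f _ [cf hf].
  exists (fun r => Then (unpair_program r) (Then (Loop (r + 1) (cf (r + 2)))
    (Loop (r + 2) (Incr (r + 0))))) => p s r i o c.
  rewrite -[in X in exec _ _ _ X]regs_pad.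
  apply: ExecThen (exec_unpair _ _ _ _ _ _) _.
  case: (unpair_nat c) => n x /=.
  apply: (@ExecThen _ _ _ _ (regs s r [:: 0; 0; iter n f x], i, o)).
    pose S k := [:: 0; k; iter (n - k) f x].
    have -> : [:: 0; n; x] = S n by rewrite /S subnn.
    rewrite -[in X in exec _ _ _ X](subn0 n).
    apply: (@exec_loop _ _ _ _ _ 1 _ S) => // k lt; rewrite /S /=.
    rewrite (_ : n - k = (n - k.+1).+1); last lia.
    exact: (exec_in_place _ _ _ _ _ [:: 0; k] _ hf).
  exact: (exec_move _ _ _ _ _ (a := 2) (b := 0)).
Qed.

(** * Machines that transform streams *)

Lemma halted_run M p t t' : halted M p (run M p t) -> t <= t' -> run M p t' = run M p t.
Proof.
move=> ht /subnKC <-; elim: (t' - t) => [|d IHd]; first by rewrite addn0.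
rewrite addnS /run iterS -/(run _ _ _) IHd /step.
by move: ht; rewrite /halted has_filter negbK => /eqP->.
Qed.

Section StreamMachine.
Variables (g : nat -> nat) (cg : nat -> command).
Hypothesis g_in_place : in_place g cg.

(* Register 0 tells whether to go on, register 1 holds the state, and the next
   number of the input is fetched into register 2. *)
Definition stream_body : command :=
  Then (Fetch 2) (Then (Loop 1 (Incr 3)) (Then (pair_program 1) (Then (cg 1)
    (Then (unpair_program 1) (Then (Loop 2 (Incr 1))
      (Cond 3
        (Cond 3 (Then (Loop 3 (Print 1)) (Then (Print 2) (Incr 0))) Skip)
        (Incr 0))))))).

Definition stream_command : command := Then (Incr 0) (Loop 0 stream_body).

(* Besides the new state, [g] returns 0 to go on silently, 1 to halt, and [w.+2]
   to write [w] and go on. *)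
Definition emission (v : nat) : seq nat :=
  if v is w.+2 then rcons (nseq w 1) 2 else [::].

(** Register 0 is 0 at first because the test of the surrounding [Loop] has just consumed the flag;
    the body restores it unless the machine is to halt. *)
Lemma exec_stream_body p st i o st' v :
  unpair_nat (g (pair_nat (p i) st)) = (st', v) ->
  exec p stream_body (regs (fun=> 0) 0 [:: 0; st], i, o)
    (regs (fun=> 0) 0 [:: nat_of_bool (v != 1); st'], i.+1, o ++ emission v).
Proof.
move=> c.
set z : store := fun=> 0; set z1 := regs z 0 [:: 0].
have z1E l : regs z 0 (0 :: l) = regs z1 1 l by apply: (regs_cat z 0 [:: 0] l).
apply: (@ExecThen _ _ _ _ (regs z 0 [:: 0; st; p i], i.+1, o)).
  have -> : regs z 0 [:: 0; st; p i] =
      update (regs z 0 [:: 0; st]) 2 (regs z 0 [:: 0; st] 2 + p i).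
    by rewrite (regs_update z 0 _ 2).
  exact: ExecFetch.
apply: (@ExecThen _ _ _ _ (regs z 0 [:: 0; 0; p i; st], i.+1, o)).
  exact (exec_move p z 0 i.+1 o (a := 1) (b := 3) [:: 0; st; p i] isT).
rewrite !z1E; apply: ExecThen (exec_pair _ _ _ _ _ _ _) _.
apply: ExecThen (g_in_place _ _ _ _ _ _) _.
apply: ExecThen (exec_unpair _ _ _ _ _ _) _.
rewrite c /=.
rewrite -z1E; apply: (@ExecThen _ _ _ _ (regs z 0 [:: 0; st'; 0; v], i.+1, o)).
  exact (exec_move p z 0 i.+1 o (a := 2) (b := 1) [:: 0; 0; st'; v] isT).
have flag k b : exec p (Incr 0) (regs z 0 [:: 0; st'; 0; 0], k, b)
    (regs z 0 [:: 1; st'], k, b).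
  have -> : regs z 0 [:: 1; st'] = regs z 0 [:: 1; st'; 0; 0].
    by rewrite -(regs_cat0 _ _ [:: 1; st']) -regs_cat0.
  exact (exec_incr p z 0 k b 0 [:: 0; st'; 0; 0]).
have upd3 l a v' : update (regs z 0 l) a v' = regs z 0 (set_nth 0 l a v').
  exact: regs_update.
case: v c => [|[|w]] _ /=; rewrite ?cats0.
- by apply: ExecCond0 => //; apply: flag.
- apply: (@ExecCondS _ _ _ _ _ _ _ 0) => //; apply: ExecCond0; first by rewrite upd3.
  rewrite upd3 /= -[[:: 0; st'; 0; 0]]/(rcons (rcons [:: 0; st'] 0) 0) !regs_cat0.
  exact: ExecSkip.
- apply: (@ExecCondS _ _ _ _ _ _ _ w.+1) => //; rewrite upd3 /=.
  apply: (@ExecCondS _ _ _ _ _ _ _ w); rewrite // upd3 /=.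
  apply: (@ExecThen _ _ _ _ (regs z 0 [:: 0; st'; 0; 0], i.+1, o ++ nseq w 1)).
    elim: w o {flag} => [|w IHw] o; first by rewrite cats0; apply: ExecLoop0.
    apply: (@ExecLoopS _ _ _ _ _ _ w _ _ _ (ExecPrint _ _ _ _ _)) => //.
    by rewrite upd3 /= -cat_rcons; apply: IHw.
  apply: ExecThen (ExecPrint _ _ _ _ _) _.
  by rewrite rcons_cat; apply: flag.
Qed.

Lemma stream_compile s t n : compile stream_command s t n =
  compile (Incr 0) s n n.+1 ++ compile (Loop 0 stream_body) n t n.+1.
Proof. by rewrite /= addn0. Qed.

(** State 0 is the entry and the states from 1 to [fresh_states stream_command] are internal to the
    program; the one after them, [stream_start.-1], is left for the exit. *)
Definition stream_start := (fresh_states stream_command).+2.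

(* The states above [stream_start] form a countdown that puts [i] into register
   1, so that the code of the machine is an explicit function of [i]. *)
Fixpoint stream_chain (i : nat) : machine :=
  if i is j.+1 then
    compile (Incr 1) (stream_start + j.+1) (stream_start + j) 0 ++ stream_chain j
  else compile stream_command stream_start stream_start.-1 1.

Definition stream_machine (i : nat) : machine :=
  Quadruple 0 (Work 0) 0 (Write 0 0) (stream_start + i) :: stream_chain i.

(** The third clause is what makes the machine halt: no quadruple starts in the exit state. *)
Lemma stream_chain_state i q : q \in stream_chain i ->
  [/\ 0 < state q, state q <= stream_start + i & state q != stream_start.-1].
Proof.
elim: i => [|i IHi].
  by move/compile_state; rewrite /stream_start addn0 add1n /=; case=> [->|]; split; lia.
rewrite mem_cat => /orP[/compile_state|/IHi[]]; last by split; lia.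
by rewrite /stream_start /=; case=> [->|]; split; lia.
Qed.

Lemma stream_chain_subset j i : j < i ->
  {subset compile (Incr 1) (stream_start + j.+1) (stream_start + j) 0 <= stream_chain i}.
Proof.
elim: i => // i IHi; rewrite ltnS leq_eqVlt => /orP[/eqP->|/IHi sub] q qc.
  by rewrite mem_cat qc.
by rewrite mem_cat sub ?orbT.
Qed.

Lemma stream_machine_deterministic i : deterministic (stream_machine i).
Proof.
rewrite /stream_machine -cat1s; apply: deterministic_cat => [||q1 q2].
- by move=> q1 q2; rewrite !inE => /eqP-> /eqP->.
- elim: i => [|i IHi].
    by apply: deterministic_compile; rewrite /stream_start add1n leqnSn orbT.
  apply: deterministic_cat IHi _ => [|q1 q2].
    by apply: deterministic_compile; rewrite addn0 orbT.
  move=> /compile_state + /stream_chain_state[]; rewrite addn0.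
  by case=> [->|]; lia.
- by rewrite inE => /eqP-> /stream_chain_state[/=]; lia.
Qed.

Section Run.
Variables (p : baire) (i : nat).

Fixpoint stream_state (n : nat) : nat :=
  if n is m.+1 then (unpair_nat (g (pair_nat (p m) (stream_state m)))).1 else i.

Definition stream_value (n : nat) : nat :=
  (unpair_nat (g (pair_nat (p n) (stream_state n)))).2.

Lemma stream_step n : unpair_nat (g (pair_nat (p n) (stream_state n))) =
  (stream_state n.+1, stream_value n).
Proof. by rewrite -surjective_pairing. Qed.

Let M := stream_machine i.
Let dM : deterministic M := @stream_machine_deterministic i.

Lemma stream_subset : {subset compile stream_command stream_start stream_start.-1 1 <= M}.
Proof.
move=> q qc; rewrite inE; apply/orP; right.
by elim: i => // j IHj; rewrite mem_cat IHj orbT.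
Qed.

Lemma stream_subset_loop :
  {subset compile (Loop 0 stream_body) 1 stream_start.-1 2 <= M}.
Proof.
move=> q qc; apply: stream_subset.
by rewrite stream_compile mem_cat qc orbT.
Qed.

Lemma reaches_run c c' : (exists t, run M p t = c) -> reaches M p c c' ->
  exists t, run M p t = c'.
Proof. by move=> [t <-] [n <-]; exists (n.+1 + t); rewrite /run iterD. Qed.

Lemma stream_prelude : exists t,
  holds p (regs (fun=> 0) 0 [:: 1; i], 0, [::]) 1 (run M p t).
Proof.
set z : store := fun=> 0.
have [t ht] : exists t, holds p (regs z 0 [:: 0; i - i], 0, [::]) (stream_start + i) (run M p t).
  exists 1.
  have m0 : Quadruple 0 (Work 0) 0 (Write 0 0) (stream_start + i) \in M by rewrite mem_head.
  rewrite /run /= (step_deterministic dM m0) //= subnn.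
  exists (set_work (fun=> ([::], [::])) 0 (tape_write 0 ([::], [::]))) => //= r.
  have -> : regs z 0 [:: 0; 0] r = 0 by case: r => [|[|[|r]]].
  by rewrite /set_work; case: ifP => _; [exists 0, 1|exists 0, 0].
(* The countdown starts at [j = i] with register 1 empty, so the induction is on [i - j]. *)
have chain j : j <= i -> exists t,
    holds p (regs z 0 [:: 0; i - j], 0, [::]) (stream_start + j) (run M p t).
  move=> le; rewrite -(subKn le); elim: (i - j) (leq_subr j i) => [|d IHd] led.
    by rewrite subn0; exists t.
  have {IHd}[t' ht'] := IHd (ltnW led).
  have E : i - d = (i - d.+1).+1 by lia.
  have sub : {subset compile (Incr 1) (stream_start + (i - d)) (stream_start + (i - d.+1)) 0 <= M}.
    rewrite E => q qc; rewrite inE; apply/orP; right.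
    by apply: (stream_chain_subset (j := i - d.+1)) qc; lia.
  have := exec_incr p z 0 0 [::] 1 [:: 0; i - (i - d)].
  move=> /(compile_correct dM sub) /(_ ht')[cf /reaches_run [|t'' <- h]]; first by exists t'.
  exists t''; move: h; rewrite /= (_ : (i - (i - d)).+1 = i - (i - d.+1)) //; lia.
have [t0 h0] := chain 0 (leq0n _); rewrite addn0 subn0 in h0.
have sub : {subset compile (Incr 0) stream_start 1 2 <= M}.
  move=> q qc; apply: stream_subset.
  by rewrite stream_compile mem_cat qc.
have := exec_incr p z 0 0 [::] 0 [:: 0; i].
move=> /(compile_correct dM sub) /(_ h0)[cf /reaches_run [|t'' <- h]]; first by exists t0.
by exists t''.
Qed.

Definition stream_output n : seq nat := flatten [seq emission (stream_value k) | k <- iota 0 n].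

Lemma stream_outputS n : stream_output n.+1 = stream_output n ++ emission (stream_value n).
Proof. by rewrite /stream_output -addn1 iotaD map_cat flatten_cat /= cats0. Qed.

(** State 1 is the test of the main loop. The bound [n <= t] is for [stream_halts]: without the
    value 1, configurations that can still move occur after any supposed halting time. *)
Lemma stream_run n : (forall k, k < n -> stream_value k != 1) -> exists2 t, n <= t &
  holds p (regs (fun=> 0) 0 [:: 1; stream_state n], n, stream_output n) 1 (run M p t).
Proof.
elim: n => [|n IHn] v1; first by have [t ht] := stream_prelude; exists t.
have [|t le ht] := IHn; first by move=> k lt; apply: v1; apply: ltnW.
have body cf :
    holds p (update (regs (fun=> 0) 0 [:: 1; stream_state n]) 0 0, n, stream_output n) 3 cf ->
    exists2 cf', reaches M p cf cf' &
      holds p (regs (fun=> 0) 0 [:: 1; stream_state n.+1], n.+1, stream_output n.+1) 1 cf'.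
  have := exec_stream_body (stream_output n) (stream_step n).
  rewrite v1 // -stream_outputS.
  rewrite (regs_update _ 0 _ 0).
  apply: (@compile_correct _ _ _ _ _ 3 1 4) => // q qc; apply: stream_subset_loop.
  by rewrite /= -[_ :: _]/([:: _; _; _] ++ _) mem_cat qc orbT.
have [cf [m rm] h] := compile_loop_step dM stream_subset_loop (erefl _) body ht.
exists (m.+1 + t); first by lia.
by rewrite /run iterD -/(run _ _ _) rm.
Qed.

Lemma stream_halts : halts M p <-> exists n, stream_value n = 1.
Proof.
split=> [[t ht]|ex].
  apply: contrapT => nex.
  have [|t' le ht'] := @stream_run t; first by move=> k _; apply/eqP=> v1; case: nex; exists k.
  have := ht; rewrite -(halted_run ht le).
  move=> /hasPn /(_ _ (stream_subset_loop (mem_head _ _))).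
  case: ht' => w -> /(_ 0) /tape_holds_read h.
  by rewrite /applicable /= h.
have {}ex : exists n, stream_value n == 1 by case: ex => n <-; exists n.
(* For the least such [n] all earlier rounds continue, so [stream_run] leads up to round [n], which
   leaves the flag at 0. *)
case: (ex_minnP ex) => n /eqP v1 min.
have [k lt|t le ht] := @stream_run n.
  by apply/negP=> /min; lia.
have := exec_stream_body (stream_output n) (stream_step n).
rewrite v1 /= -(regs_update _ 0 [:: 1; stream_state n] 0) => e.
have [cf /reaches_run [|t' <- [w E _]]] :=
  compile_correct dM stream_subset_loop
    (@ExecLoopS _ 0 _ _ _ _ 0 _ _ erefl e (ExecLoop0 _ _ _ _ erefl)) ht.
  by exists t.
exists t'; apply/hasPn=> q; rewrite E /applicable /= inE => /orP[/eqP->//|].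
by move=> /stream_chain_state[_ _] /negPf->.
Qed.

End Run.
End StreamMachine.

(** * Primitive recursive functions between coded types *)

(* Codes are bijective, so that identities are primitive recursive.  Booleans
   therefore have no code; they enter by [nat_of_bool]. *)
Class coded (A : Type) := Coded {
  code : A -> nat;
  decode : nat -> A;
  codeK : cancel code decode;
  decodeK : cancel decode code }.

#[export] Instance coded_nat : coded nat := @Coded nat id id (fun=> erefl) (fun=> erefl).

Lemma decode_tapeK : cancel decode_tape code_tape. Proof. by case. Qed.

Lemma decode_actionK : cancel decode_action code_action.
Proof.
move=> n; rewrite /decode_action -{2}(unpair_natK n).
by case: (unpair_nat n) => [[|[|[|i]]] m] /=; rewrite ?decode_tapeK.
Qed.

Lemma decode_quadrupleK : cancel decode_quadruple code_quadruple.
Proof.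
move=> n; rewrite /decode_quadruple -{2}(unpair_natK n).
case: (unpair_nat n) => q m /=; rewrite -{2}(unpair_natK m).
case: (unpair_nat m) => t b /=; rewrite -{2}(unpair_natK b).
case: (unpair_nat b) => k a /=; rewrite -{2}(unpair_natK a).
case: (unpair_nat a) => c d /=.
by rewrite /code_quadruple /= decode_tapeK decode_actionK.
Qed.

#[export] Instance coded_tape_name : coded tape_name := Coded code_tapeK decode_tapeK.
#[export] Instance coded_action : coded action := Coded code_actionK decode_actionK.
#[export] Instance coded_quadruple : coded quadruple :=
  Coded code_quadrupleK decode_quadrupleK.

Section Containers.
Context {A B : Type} {cA : coded A} {cB : coded B}.

Definition code_pair (x : A * B) := pair_nat (code x.1) (code x.2).
Definition decode_pair n : A * B :=
  (decode (unpair_nat n).1, decode (unpair_nat n).2).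
Lemma code_pairK : cancel code_pair decode_pair.
Proof. by case=> a b; rewrite /decode_pair pair_natK /= !codeK. Qed.
Lemma decode_pairK : cancel decode_pair code_pair.
Proof. by move=> n; rewrite /code_pair !decodeK unpair_natK. Qed.

Definition code_option (x : option A) := if x is Some a then (code a).+1 else 0.
Definition decode_option n : option A :=
  if n is m.+1 then Some (decode m) else None.
Lemma code_optionK : cancel code_option decode_option.
Proof. by case=> //= a; rewrite codeK. Qed.
Lemma decode_optionK : cancel decode_option code_option.
Proof. by case=> //= n; rewrite decodeK. Qed.

Fixpoint code_list (l : seq A) :=
  if l is a :: l' then (pair_nat (code a) (code_list l')).+1 else 0.
Fixpoint decode_list (fuel n : nat) : seq A :=
  match fuel, n with
  | fuel'.+1, n'.+1 =>
      decode (unpair_nat n').1 :: decode_list fuel' (unpair_nat n').2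
  | _, _ => [::]
  end.
Lemma code_list_fuelK l k : code_list l <= k -> decode_list k (code_list l) = l.
Proof.
elim: l k => [|a l IHl] [|k] //=; rewrite ltnS => le.
by rewrite pair_natK codeK IHl // (leq_trans _ le) //; case: (leq_pair_nat (code a) (code_list l)).
Qed.
Lemma decode_list_fuelK k n : n <= k -> code_list (decode_list k n) = n.
Proof.
elim: k n => [|k IHk] [|n] //=; rewrite ltnS => le.
rewrite decodeK IHk ?unpair_natK // (leq_trans _ le) //.
by case: (unpair_nat_le n).
Qed.
Lemma code_listK : cancel code_list (fun n => decode_list n n).
Proof. by move=> l; apply: code_list_fuelK. Qed.
Lemma decode_listK : cancel (fun n => decode_list n n) code_list.
Proof. by move=> n; apply: decode_list_fuelK. Qed.
End Containers.

#[export] Instance coded_pair A B (cA : coded A) (cB : coded B) : coded (A * B) :=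
  Coded code_pairK decode_pairK.
#[export] Instance coded_option A (cA : coded A) : coded (option A) :=
  Coded code_optionK decode_optionK.
#[export] Instance coded_seq A (cA : coded A) : coded (seq A) :=
  Coded code_listK decode_listK.

Lemma code_machineE (M : machine) : code_machine M = code (M : seq quadruple).
Proof. by elim: M => //= q M ->. Qed.

Lemma machine_of_decode i : machine_of i = decode i :> seq quadruple.
Proof.
rewrite /machine_of [decode i]/=; move: {2 4}i => k; elim: i k => // i IHi [|n] //=.
by case: (unpair_nat n) => r m; rewrite IHi.
Qed.

Definition pr {A B} {cA : coded A} {cB : coded B} (f : A -> B) :=
  prec (fun c => code (f (decode c))).

Lemma prec_const n : prec (fun=> n).
Proof. by elim: n => [|n IHn]; [apply: prec_0|apply: (prec_comp prec_S IHn)]. Qed.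

Section Rules.
Context {A B C D : Type} {cA : coded A} {cB : coded B} {cC : coded C} {cD : coded D}.

Lemma eq_pr (f g : A -> B) : f =1 g -> pr f -> pr g.
Proof. by move=> /funext->. Qed.

Lemma pr_const (b : B) : pr (fun _ : A => b).
Proof. exact: prec_const. Qed.

Lemma pr_id : pr (fun a : A => a).
Proof. by have := prec_id; congr prec; apply/funext=> c; rewrite decodeK. Qed.

Lemma pr_comp (g : B -> C) (f : A -> B) : pr g -> pr f -> pr (fun a => g (f a)).
Proof.
move=> pg pf; have := prec_comp pg pf; congr prec.
by apply/funext=> c /=; rewrite codeK.
Qed.

Lemma pr_pair (f : A -> B) (g : A -> C) : pr f -> pr g -> pr (fun a => (f a, g a)).
Proof. exact: prec_pair. Qed.

Lemma pr_fst (f : A -> B * C) : pr f -> pr (fun a => (f a).1).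
Proof.
move=> pf; have := prec_comp prec_fst pf; congr prec.
by apply/funext=> c /=; rewrite pair_natK.
Qed.

Lemma pr_snd (f : A -> B * C) : pr f -> pr (fun a => (f a).2).
Proof.
move=> pf; have := prec_comp prec_snd pf; congr prec.
by apply/funext=> c /=; rewrite pair_natK.
Qed.

Lemma pr_code (f : A -> B) : pr f -> pr (fun a => code (f a)).
Proof. by []. Qed.

Lemma pr_decode (f : A -> nat) : pr f -> pr (fun a => decode (f a) : B).
Proof. by move=> pf; have := pf; congr prec; apply/funext=> c; rewrite decodeK. Qed.

Lemma pr_iter (n : A -> nat) (f : A -> B -> B) (x : A -> B) :
  pr n -> pr (fun y => f y.1 y.2) -> pr x -> pr (fun a => iter (n a) (f a) (x a)).
Proof.
move=> pn pf px.
(* [prec_iter] has no room for a parameter, so the code of [a] travels along in the first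
   component. *)
pose F c := pair_nat (unpair_nat c).1
  (@code B cB (f (@decode A cA (unpair_nat c).1) (@decode B cB (unpair_nat c).2))).
have pF : prec F by exact: prec_pair prec_fst pf.
have := prec_comp prec_snd
  (prec_comp (prec_iter pF) (prec_pair pn (prec_pair prec_id px))).
congr prec; apply/funext=> c /=; rewrite pair_natK /=.
set a := decode c; elim: (n a) => [|m IHm] /=; first by rewrite pair_natK.
have E : (unpair_nat (iter m F (pair_nat c (code (x a))))).1 = c.
  by elim: (m) => [|m' IHm'] /=; rewrite pair_natK.
by rewrite /F pair_natK /= -/F E IHm codeK.
Qed.

Lemma pr_S (f : A -> nat) : pr f -> pr (fun a => (f a).+1).
Proof. exact: prec_comp prec_S. Qed.

End Rules.

Lemma pr_comp2 {A B C D} {cA : coded A} {cB : coded B} {cC : coded C} {cD : coded D}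
    (g : B -> C -> D) (f1 : A -> B) (f2 : A -> C) :
  pr (fun y => g y.1 y.2) -> pr f1 -> pr f2 -> pr (fun a => g (f1 a) (f2 a)).
Proof. by move=> pg p1 p2; apply: (pr_comp pg (pr_pair p1 p2)). Qed.

Lemma pr_comp3 {A B C D E} {cA : coded A} {cB : coded B} {cC : coded C} {cD : coded D}
    {cE : coded E} (g : B -> C -> D -> E) (f1 : A -> B) (f2 : A -> C) (f3 : A -> D) :
  pr (fun y => g y.1.1 y.1.2 y.2) -> pr f1 -> pr f2 -> pr f3 ->
  pr (fun a => g (f1 a) (f2 a) (f3 a)).
Proof. by move=> pg p1 p2 p3; apply: (pr_comp pg (pr_pair (pr_pair p1 p2) p3)). Qed.

Ltac pr_step := first
  [ exact: pr_id | simple apply pr_const | assumption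
  | simple apply pr_pair | simple apply pr_S | simple apply pr_fst | simple apply pr_snd
  | simple apply pr_iter ].
Ltac pr := repeat (cbv beta; pr_step).

Section Cases.
Context {A B C : Type} {cA : coded A} {cB : coded B} {cC : coded C}.

Lemma pr_case_nat (n : A -> nat) (x : A -> B) (f : A -> nat -> B) :
  pr n -> pr x -> pr (fun y => f y.1 y.2) ->
  pr (fun a => if n a is m.+1 then f a m else x a).
Proof.
move=> pn px pf.
(* The first component counts rounds; hence the last round applies [f a] to the predecessor of
   [n a]. *)
apply: (@eq_pr _ _ _ _ (fun a => (iter (n a) (fun z => (z.1.+1, f a z.1)) (0, x a)).2)).
  move=> a; have E k : (iter k (fun z => (z.1.+1, f a z.1)) (0, x a)).1 = k.
    by elim: k => //= k ->.
  by case: (n a) => //= k; rewrite E.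
pr; apply: (pr_comp2 pf); pr.
Qed.

Lemma pr_if (b : A -> bool) (x y : A -> B) : pr (fun a => nat_of_bool (b a)) ->
  pr x -> pr y -> pr (fun a => if b a then x a else y a).
Proof.
move=> pb px py.
apply: (@eq_pr _ _ _ _ (fun a => if nat_of_bool (b a) is _.+1 then x a else y a)).
  by move=> a; case: (b a).
apply: (pr_case_nat (f := fun a _ => x a)); pr; apply: (pr_comp px); pr.
Qed.

Lemma pr_case_option (o : A -> option C) (x : A -> B) (f : A -> C -> B) :
  pr o -> pr x -> pr (fun y => f y.1 y.2) ->
  pr (fun a => if o a is Some c then f a c else x a).
Proof.
move=> po px pf.
apply: (@eq_pr _ _ _ _ (fun a => if code (o a) is m.+1 then f a (decode m) else x a)).
  by move=> a; case: (o a) => //= c; rewrite codeK.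
apply: (@pr_case_nat (fun a => code (o a)) _ (fun a m => f a (decode m))) => //.
Qed.

Lemma pr_case_seq (l : A -> seq C) (x : A -> B) (f : A -> C -> seq C -> B) :
  pr l -> pr x -> pr (fun y => f y.1.1 y.1.2 y.2) ->
  pr (fun a => if l a is c :: l' then f a c l' else x a).
Proof.
move=> pl px pf.
pose F a m := let y := @decode _ (coded_pair cC (coded_seq cC)) m in f a y.1 y.2.
apply: (@eq_pr _ _ _ _ (fun a => if code (l a) is m.+1 then F a m else x a)).
  move=> a; case: (l a) => // c l'.
  by rewrite /F /= /decode_pair pair_natK /= codeK code_list_fuelK.
apply: (@pr_case_nat (fun a => code (l a)) _ F) => //.
by apply: (pr_comp3 pf); pr; apply: pr_decode; pr.
Qed.

Lemma pr_Some (f : A -> B) : pr f -> pr (fun a => Some (f a)).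
Proof. exact: prec_comp prec_S. Qed.

Lemma pr_cons (f : A -> B) (l : A -> seq B) : pr f -> pr l -> pr (fun a => f a :: l a).
Proof. by move=> pf pl; apply: prec_comp prec_S (prec_pair pf pl). Qed.

End Cases.

Section Arithmetic1.
Context {A : Type} {cA : coded A}.
Implicit Types (m n : A -> nat) (b c : A -> bool).

Lemma pr_pred n : pr n -> pr (fun a => (n a).-1).
Proof.
move=> pn; apply: (@eq_pr _ _ _ _ (fun a => if n a is m.+1 then m else 0)).
  by move=> a; case: (n a).
by apply: (pr_case_nat (f := fun _ k => k)); pr.
Qed.

Lemma pr_add m n : pr m -> pr n -> pr (fun a => m a + n a).
Proof.
move=> pm pn; apply: (@eq_pr _ _ _ _ (fun a => iter (n a) S (m a))); last by pr.
by move=> a; elim: (n a) => [|k IHk]; rewrite ?addn0 // addnS -IHk.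
Qed.

End Arithmetic1.

Section Arithmetic2.
Context {A : Type} {cA : coded A}.
Implicit Types (m n : A -> nat) (b c : A -> bool).

Lemma pr_sub m n : pr m -> pr n -> pr (fun a => m a - n a).
Proof.
move=> pm pn; apply: (@eq_pr _ _ _ _ (fun a => iter (n a) predn (m a))).
  by move=> a; elim: (n a) => [|k IHk]; rewrite ?subn0 // subnS -IHk.
apply: (@pr_iter _ _ _ _ n (fun _ => predn) m) => //; simple apply pr_pred; pr.
Qed.

Lemma pr_not b : pr (fun a => nat_of_bool (b a)) -> pr (fun a => nat_of_bool (~~ b a)).
Proof.
move=> pb; apply: (@eq_pr _ _ _ _ (fun a => 1 - b a)); first by move=> a; case: (b a).
by simple apply pr_sub; pr.
Qed.

Lemma pr_and b c : pr (fun a => nat_of_bool (b a)) -> pr (fun a => nat_of_bool (c a)) ->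
  pr (fun a => nat_of_bool (b a && c a)).
Proof.
move=> pb pc; apply: (@eq_pr _ _ _ _ (fun a => if b a then nat_of_bool (c a) else 0)).
  by move=> a; case: (b a).
by apply: pr_if; pr.
Qed.

Lemma pr_leq m n : pr m -> pr n -> pr (fun a => nat_of_bool (m a <= n a)).
Proof.
move=> pm pn; apply: (@eq_pr _ _ _ _ (fun a => if m a - n a is _.+1 then 0 else 1)).
  by move=> a; rewrite /leq; case: (m a - n a).
by apply: (pr_case_nat (f := fun _ _ => 0)); pr; apply: pr_sub.
Qed.

Lemma pr_eq m n : pr m -> pr n -> pr (fun a => nat_of_bool (m a == n a)).
Proof.
move=> pm pn; apply: (@eq_pr _ _ _ _ (fun a => nat_of_bool ((m a <= n a) && (n a <= m a)))).
  by move=> a; rewrite -eqn_leq.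
by apply: pr_and; apply: pr_leq.
Qed.

End Arithmetic2.

Section Arithmetic3.
Context {A : Type} {cA : coded A}.
Implicit Types (m n : A -> nat) (b c : A -> bool).

Lemma pr_odd n : pr n -> pr (fun a => nat_of_bool (odd (n a))).
Proof.
move=> pn; apply: (@eq_pr _ _ _ _ (fun a => iter (n a) (fun k => 1 - k) 0)).
  by move=> a; elim: (n a) => //= k ->; case: (odd k).
by pr; simple apply pr_sub; pr.
Qed.

Lemma pr_half n : pr n -> pr (fun a => (n a)./2).
Proof.
move=> pn.
apply: (@eq_pr _ _ _ _ (fun a => (iter (n a) (fun z => (z.2, z.1.+1)) (0, 0)).1)); last by pr.
move=> a; suff -> k : iter k (fun z => (z.2, z.1.+1)) (0, 0) = (k./2, uphalf k) by [].
by elim: k => //= k ->.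
Qed.

Lemma pr_unpair n : pr n -> pr (fun a => unpair_nat (n a)).
Proof.
move=> pn; apply: (@eq_pr _ _ _ _ (fun a => decode (n a) : nat * nat)).
  by move=> a /=; rewrite /decode_pair /=; case: (unpair_nat _).
exact: pr_decode.
Qed.

Lemma pr_pair_nat m n : pr m -> pr n -> pr (fun a => pair_nat (m a) (n a)).
Proof. exact: prec_pair. Qed.

End Arithmetic3.

Ltac pr_step ::= first
  [ assumption | simple apply pr_id | simple apply pr_const
  | simple apply pr_pair | simple apply pr_S | simple apply pr_fst | simple apply pr_snd
  | simple apply pr_cons | simple apply pr_Some
  | simple apply pr_pred | simple apply pr_add | simple apply pr_sub | simple apply pr_half
  | simple apply pr_unpair | simple apply pr_pair_nat
  | simple apply pr_and | simple apply pr_not | simple apply pr_leq | simple apply pr_eq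
  | simple apply pr_odd
  | simple apply pr_if | simple apply pr_iter ].

Section Lists.
Context {A B C : Type} {cA : coded A} {cB : coded B} {cC : coded C}.

Lemma size_code_list (l : seq C) : size l <= code l.
Proof.
elim: l => //= c l IHl; rewrite ltnS (leq_trans IHl) //.
by case: (leq_pair_nat (code c) (code l)).
Qed.

Lemma pr_foldl (l : A -> seq C) (x : A -> B) (f : A -> B -> C -> B) :
  pr l -> pr x -> pr (fun y => f y.1.1 y.1.2 y.2) ->
  pr (fun a => foldl (f a) (x a) (l a)).
Proof.
move=> pl px pf.
(* The code of a list bounds its length and can serve as the number of rounds, since rounds on an
   exhausted list change nothing. *)
pose F a (z : seq C * B) := if z.1 is c :: l' then (l', f a z.2 c) else z.
apply: (@eq_pr _ _ _ _ (fun a => (iter (code (l a)) (F a) (l a, x a)).2)).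
  move=> a; have := size_code_list (l a); move: (code _) => n.
  elim: n (l a) (x a) => [|n IHn] [|c l'] y // le; rewrite iterSr IHn //.
apply: pr_snd; apply: pr_iter; [exact: pr_code|..|pr].
apply: (pr_case_seq (f := fun y c l' => (l', f y.1 y.2.2 c))); pr.
by apply: (pr_comp3 pf); pr.
Qed.

End Lists.

Lemma pr_rev A C {cA : coded A} {cC : coded C} (l : A -> seq C) : pr l -> pr (fun a => rev (l a)).
Proof.
move=> pl; apply: (@eq_pr _ _ _ _ (fun a => foldl (fun l' c => c :: l') [::] (l a))).
  by move=> a; rewrite /rev; elim: (l a) [::] => /=.
by apply: pr_foldl; pr.
Qed.

Ltac pr_step ::= first
  [ assumption | simple apply pr_id | simple apply pr_const
  | simple apply pr_pair | simple apply pr_S | simple apply pr_fst | simple apply pr_snd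
  | simple apply pr_cons | simple apply pr_Some
  | simple apply pr_pred | simple apply pr_add | simple apply pr_sub | simple apply pr_half
  | simple apply pr_unpair | simple apply pr_pair_nat
  | simple apply pr_and | simple apply pr_not | simple apply pr_leq | simple apply pr_eq
  | simple apply pr_odd
  | simple apply pr_if | simple apply pr_rev | simple apply pr_foldl | simple apply pr_iter ].

Section Lists2.
Context {A B C : Type} {cA : coded A} {cB : coded B} {cC : coded C}.

Lemma pr_foldr (l : A -> seq C) (x : A -> B) (f : A -> C -> B -> B) :
  pr l -> pr x -> pr (fun y => f y.1.1 y.1.2 y.2) ->
  pr (fun a => foldr (f a) (x a) (l a)).
Proof.
move=> pl px pf.
apply: (@eq_pr _ _ _ _ (fun a => foldl (fun y c => f a c y) (x a) (rev (l a)))).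
  by move=> a; rewrite foldl_rev.
by pr; apply: (pr_comp3 pf); pr.
Qed.

Lemma pr_behead (l : A -> seq C) : pr l -> pr (fun a => behead (l a)).
Proof. by move=> pl; apply: (pr_case_seq (f := fun _ _ l' => l')); pr. Qed.

Lemma pr_head (c : C) (l : A -> seq C) : pr l -> pr (fun a => head c (l a)).
Proof. by move=> pl; apply: (pr_case_seq (x := fun=> c) (f := fun _ c _ => c)); pr. Qed.

Lemma pr_size (l : A -> seq C) : pr l -> pr (fun a => size (l a)).
Proof.
move=> pl; apply: (@eq_pr _ _ _ _ (fun a => foldl (fun n _ => n.+1) 0 (l a))); last by pr.
move=> a; rewrite -[RHS]add0n; elim: (l a) 0 => [|c l' IHl'] n /=; first by rewrite addn0.
by rewrite IHl' addSnnS.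
Qed.

Lemma pr_nseq (n : A -> nat) (x : A -> B) : pr n -> pr x -> pr (fun a => nseq (n a) (x a)).
Proof.
move=> pn px; apply: (@eq_pr _ _ _ _ (fun a => iter (n a) (cons (x a)) [::])) => [a|].
  by elim: (n a) => //= k ->.
by pr; apply: (pr_comp px); pr.
Qed.

End Lists2.

Section Lists3.
Context {A B C : Type} {cA : coded A} {cB : coded B} {cC : coded C}.

Lemma pr_cat (l1 l2 : A -> seq B) : pr l1 -> pr l2 -> pr (fun a => l1 a ++ l2 a).
Proof.
move=> p1 p2; apply: (@eq_pr _ _ _ _ (fun a => foldr cons (l2 a) (l1 a))).
  by move=> a; elim: (l1 a) => //= c l ->.
by apply: (pr_foldr (f := fun _ => cons)); pr.
Qed.

Lemma pr_nth (c : C) (l : A -> seq C) (n : A -> nat) : pr l -> pr n ->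
  pr (fun a => nth c (l a) (n a)).
Proof.
move=> pl pn; apply: (@eq_pr _ _ _ _ (fun a => head c (iter (n a) behead (l a)))) => [a|].
  elim: (n a) (l a) => [|k IHk] l'; first by case: l'.
  by rewrite iterSr IHk; case: l' => //=; rewrite nth_nil.
by apply: pr_head; pr; simple apply pr_behead; pr.
Qed.

Lemma pr_map (l : A -> seq B) (f : A -> B -> C) : pr l -> pr (fun y => f y.1 y.2) ->
  pr (fun a => [seq f a b | b <- l a]).
Proof.
move=> pl pf; apply: (@eq_pr _ _ _ _ (fun a => foldr (fun b r => f a b :: r) [::] (l a))).
  by move=> a; elim: (l a) => //= c l' ->.
by apply: pr_foldr; pr; apply: (pr_comp2 pf); pr.
Qed.

Lemma pr_filter (l : A -> seq B) (f : A -> B -> bool) : pr l ->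
  pr (fun y => nat_of_bool (f y.1 y.2)) -> pr (fun a => [seq b <- l a | f a b]).
Proof.
move=> pl pf.
apply: (@eq_pr _ _ _ _ (fun a => foldr (fun b r => if f a b then b :: r else r) [::] (l a))).
  by move=> a; elim: (l a) => //= c l' ->.
by apply: pr_foldr; pr; apply: (pr_comp2 (g := fun a b => nat_of_bool (f a b)) pf); pr.
Qed.

End Lists3.

Section Lists4.
Context {A B : Type} {cA : coded A} {cB : coded B}.

Lemma pr_rcons (l : A -> seq B) (x : A -> B) : pr l -> pr x ->
  pr (fun a => rcons (l a) (x a)).
Proof.
move=> pl px; apply: (@eq_pr _ _ _ _ (fun a => l a ++ [:: x a])) => [a|].
  by rewrite cats1.
by apply: pr_cat; pr.
Qed.

Lemma pr_flatten (l : A -> seq (seq B)) : pr l -> pr (fun a => flatten (l a)).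
Proof. by move=> pl; apply: pr_foldr; pr; simple apply pr_cat; pr. Qed.

End Lists4.

Lemma pr_mkseq A B {cA : coded A} {cB : coded B} (f : A -> nat -> B) (n : A -> nat) :
  pr n -> pr (fun y => f y.1 y.2) -> pr (fun a => mkseq (f a) (n a)).
Proof.
move=> pn pf; apply: pr_map => //.
apply: (@eq_pr _ _ _ _ (fun a => iter (n a) (fun l => rcons l (size l)) [::])) => [a|].
  elim: (n a) => // k IHk; rewrite iterS IHk size_iota.
  by rewrite -[in RHS]addn1 iotaD cats1.
by pr; simple apply pr_rcons; pr; simple apply pr_size; pr.
Qed.

Ltac pr_step ::= first
  [ assumption | simple apply pr_id | simple apply pr_const
  | simple apply pr_pair | simple apply pr_S | simple apply pr_fst | simple apply pr_snd
  | simple apply pr_cons | simple apply pr_Some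
  | simple apply pr_pred | simple apply pr_add | simple apply pr_sub | simple apply pr_half
  | simple apply pr_unpair | simple apply pr_pair_nat
  | simple apply pr_and | simple apply pr_not | simple apply pr_leq | simple apply pr_eq
  | simple apply pr_odd | simple apply pr_if
  | simple apply pr_rev | simple apply pr_cat | simple apply pr_nseq | simple apply pr_size
  | simple apply pr_nth | simple apply pr_behead | simple apply pr_head
  | simple apply pr_rcons | simple apply pr_flatten
  | simple apply pr_mkseq | simple apply pr_filter | simple apply pr_map
  | simple apply pr_foldr | simple apply pr_foldl
  | simple apply pr_iter ].

Section Machines.
Context {A B : Type} {cA : coded A} {cB : coded B}.

Lemma pr_quadruple (q b q' : A -> nat) (t : A -> tape_name) (x : A -> action) :
  pr q -> pr t -> pr b -> pr x -> pr q' ->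
  pr (fun a => Quadruple (q a) (t a) (b a) (x a) (q' a)).
Proof.
by move=> pq pt pb px pq'; apply: prec_pair pq (prec_pair pt (prec_pair pb (prec_pair px pq'))).
Qed.

(** A quadruple and this tuple have the same code by conversion, so the fields become
    projections. *)
Let quad (q : quadruple) := (state q, (scan q, (symbol q, (act q, next q)))).

Let pr_quad (q : A -> quadruple) : pr q -> pr (fun a => quad (q a)).
Proof. by []. Qed.

Lemma pr_state (q : A -> quadruple) : pr q -> pr (fun a => state (q a)).
Proof. by move=> /pr_quad pq; apply: (pr_fst pq). Qed.

Lemma pr_scan (q : A -> quadruple) : pr q -> pr (fun a => scan (q a)).
Proof. by move=> /pr_quad pq; apply: (pr_fst (pr_snd pq)). Qed.

Lemma pr_symbol (q : A -> quadruple) : pr q -> pr (fun a => symbol (q a)).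
Proof. by move=> /pr_quad pq; apply: (pr_fst (pr_snd (pr_snd pq))). Qed.

Lemma pr_act (q : A -> quadruple) : pr q -> pr (fun a => act (q a)).
Proof. by move=> /pr_quad pq; apply: (pr_fst (pr_snd (pr_snd (pr_snd pq)))). Qed.

Lemma pr_next (q : A -> quadruple) : pr q -> pr (fun a => next (q a)).
Proof. by move=> /pr_quad pq; apply: (pr_snd (pr_snd (pr_snd (pr_snd pq)))). Qed.

End Machines.

Section Machines2.
Context {A B : Type} {cA : coded A} {cB : coded B}.

Lemma pr_case_tape_name (t : A -> tape_name) (x : A -> B) (f : A -> nat -> B) :
  pr t -> pr x -> pr (fun y => f y.1 y.2) ->
  pr (fun a => match t a with Input => x a | Work i => f a i end).
Proof.
move=> pt px pf; apply: (@eq_pr _ _ _ _ (fun a => if code (t a) is i.+1 then f a i else x a)).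
  by move=> a; case: (t a).
by apply: (@pr_case_nat _ _ _ _ (fun a => code (t a))).
Qed.

Lemma pr_case_action (x : A -> action) (f1 f2 : A -> tape_name -> B) (f3 : A -> nat -> nat -> B)
    (f4 : A -> nat -> B) : pr x -> pr (fun y => f1 y.1 y.2) -> pr (fun y => f2 y.1 y.2) ->
  pr (fun y => f3 y.1.1 y.1.2 y.2) -> pr (fun y => f4 y.1 y.2) ->
  pr (fun a => match x a with
    | MoveLeft t => f1 a t | MoveRight t => f2 a t | Write i b => f3 a i b | Emit b => f4 a b
    end).
Proof.
move=> px p1 p2 p3 p4.
pose c a := unpair_nat (code_action (x a)).
have pc : pr c by apply: (pr_unpair (n := fun a => code_action (x a))).
apply: (@eq_pr _ _ _ _ (fun a =>
  if (c a).1 is i1.+1 then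
    if i1 is i2.+1 then
      if i2 is i3.+1 then f3 a i3 (c a).2 else f4 a (c a).2
    else f2 a (decode (c a).2)
  else f1 a (decode (c a).2))).
  by move=> a; rewrite /c; case: (x a) => [t|t|i b|b];
    rewrite /code_action pair_natK //= code_tapeK.
have pcA C (cC : coded C) (g : C -> A) : pr g -> pr (fun a => c (g a)).
  by move=> pg; apply: (pr_comp pc pg).
apply: (pr_case_nat (f := fun a i1 => if i1 is i2.+1 then _ else _)); pr.
  by apply: (pr_comp2 p1); pr; apply: pr_decode; pr.
apply: (pr_case_nat (n := snd) (f := fun a i2 => if i2 is i3.+1 then _ else _)); pr.
  by apply: (pr_comp2 p2); pr; apply: pr_decode; pr; apply: pcA; pr.
apply: (pr_case_nat (n := snd) (f := fun a i3 => f3 a.1.1 i3 (c a.1.1).2)); pr.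
  by apply: (pr_comp2 p4); pr; apply: pcA; pr.
by apply: (pr_comp3 p3); pr; apply: pcA; pr.
Qed.

End Machines2.

(** * Simulation of machines *)

(** A word [l] stands for the point [nth 0 l] that continues it by zeros. *)
Lemma pr_input_symbol A {cA : coded A} (l : A -> seq nat) (h : A -> nat) :
  pr l -> pr h -> pr (fun a => input_symbol (nth 0 (l a)) (h a)).
Proof.
move=> pl ph.
apply: (@pr_case_nat _ _ _ _ h (fun=> 0) (fun a j =>
  nth 0 (flatten (mkseq (fun i => rcons (nseq (nth 0 (l a) i) 1) 2) j.+1)) j)); pr.
all: by apply: (pr_comp pl); pr.
Qed.

(* Configurations in coded form: the work tapes are a list of updates with the
   latest one first, and the output is reversed. *)
Definition sim_config : Type := nat * nat * seq (nat * (seq nat * seq nat)) * seq nat.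

Definition lookup (w : seq (nat * (seq nat * seq nat))) (j : nat) : seq nat * seq nat :=
  foldr (fun x t => if x.1 == j then x.2 else t) ([::], [::]) w.

Definition to_config (c : sim_config) : config :=
  Config c.1.1.1 c.1.1.2 (lookup c.1.2) (rev c.2).

Definition sim_read (l : seq nat) (c : sim_config) (t : tape_name) : nat :=
  match t with
  | Input => input_symbol (nth 0 l) c.1.1.2
  | Work i => head 0 (lookup c.1.2 i).2
  end.

Definition sim_perform (a : action) (s : nat) (c : sim_config) : sim_config :=
  match a with
  | MoveLeft t =>
    match t with
    | Input => (s, c.1.1.2.-1, c.1.2, c.2)
    | Work i => (s, c.1.1.2, (i, (behead (lookup c.1.2 i).1,
        head 0 (lookup c.1.2 i).1 :: (lookup c.1.2 i).2)) :: c.1.2, c.2)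
    end
  | MoveRight t =>
    match t with
    | Input => (s, c.1.1.2.+1, c.1.2, c.2)
    | Work i => (s, c.1.1.2, (i, (head 0 (lookup c.1.2 i).2 :: (lookup c.1.2 i).1,
        behead (lookup c.1.2 i).2)) :: c.1.2, c.2)
    end
  | Write i b => (s, c.1.1.2, (i, ((lookup c.1.2 i).1,
      b :: behead (lookup c.1.2 i).2)) :: c.1.2, c.2)
  | Emit b => (s, c.1.1.2, c.1.2, b :: c.2)
  end.

Definition sim_applicable (l : seq nat) (c : sim_config) (r : quadruple) : bool :=
  (state r == c.1.1.1) && (symbol r == sim_read l c (scan r)).

Definition sim_step (M : seq quadruple) (l : seq nat) (c : sim_config) : sim_config :=
  if [seq r <- M | sim_applicable l c r] is r :: _
  then sim_perform (act r) (next r) c else c.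

Definition sim_run (M : seq quadruple) (l : seq nat) (t : nat) : sim_config :=
  iter t (sim_step M l) (0, 0, [::], [::]).

Lemma lookup_cons w i t : lookup ((i, t) :: w) = set_work (lookup w) i t.
Proof. by apply/funext=> j; rewrite /set_work /= eq_sym. Qed.

Lemma to_config_perform a s c : to_config (sim_perform a s c) = perform a s (to_config c).
Proof.
case: a => [[|i]|[|i]|i b|b] //; rewrite /to_config /= ?lookup_cons //.
by rewrite rev_cons.
Qed.

Lemma sim_readE l c t : sim_read l c t = read (nth 0 l) (to_config c) t.
Proof. by case: t. Qed.

Lemma sim_applicableE l c : sim_applicable l c =1 applicable (nth 0 l) (to_config c).
Proof. by move=> r; rewrite /sim_applicable sim_readE. Qed.

Lemma to_config_step M l c : to_config (sim_step M l c) = step M (nth 0 l) (to_config c).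
Proof.
rewrite /sim_step /step (eq_filter (sim_applicableE l c)).
by case: [seq _ <- _ | _] => // r _; rewrite to_config_perform.
Qed.

Lemma to_config_run M l t : to_config (sim_run M l t) = run M (nth 0 l) t.
Proof.
elim: t => //= t IHt; rewrite to_config_step -/(sim_run M l t) IHt.
by [].
Qed.

Lemma pr_lookup A {cA : coded A} (w : A -> seq (nat * (seq nat * seq nat))) (j : A -> nat) :
  pr w -> pr j -> pr (fun a => lookup (w a) (j a)).
Proof. by move=> pw pj; apply: pr_foldr; pr; apply: (pr_comp pj); pr. Qed.

Lemma pr_sim_applicable :
  pr (fun y : seq nat * sim_config * quadruple => nat_of_bool (sim_applicable y.1.1 y.1.2 y.2)).
Proof.
apply: pr_and; simple apply pr_eq.
- by simple apply pr_state; pr.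
- by pr.
- by simple apply pr_symbol; pr.
apply: (pr_case_tape_name (t := fun y : seq nat * sim_config * quadruple => scan y.2)
  (x := fun y => input_symbol (nth 0 y.1.1) y.1.2.1.1.2)
  (f := fun y i => head 0 (lookup y.1.2.1.2 i).2)).
- by simple apply pr_scan; pr.
- by simple apply pr_input_symbol; pr.
- by pr; simple apply pr_lookup; pr.
Qed.

Lemma pr_sim_perform :
  pr (fun y : action * nat * sim_config => sim_perform y.1.1 y.1.2 y.2).
Proof.
apply: (pr_case_action (x := fun y : action * nat * sim_config => y.1.1)
  (f1 := fun y t => match t with Input => _ | Work i => _ end)
  (f2 := fun y t => match t with Input => _ | Work i => _ end)
  (f3 := fun y i b => (y.1.2, y.2.1.1.2, (i, ((lookup y.2.1.2 i).1,
      b :: behead (lookup y.2.1.2 i).2)) :: y.2.1.2, y.2.2))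
  (f4 := fun y b => (y.1.2, y.2.1.1.2, y.2.1.2, b :: y.2.2))); pr.
- apply: (pr_case_tape_name (t := snd) (x := fun y => _) (f := fun y i => _)); pr;
  by simple apply pr_lookup; pr.
- apply: (pr_case_tape_name (t := snd) (x := fun y => _) (f := fun y i => _)); pr;
  by simple apply pr_lookup; pr.
- all: by simple apply pr_lookup; pr.
Qed.

Lemma pr_sim_step :
  pr (fun y : seq quadruple * seq nat * sim_config => sim_step y.1.1 y.1.2 y.2).
Proof.
apply: (pr_case_seq (l := fun y : seq quadruple * seq nat * sim_config =>
    [seq r <- y.1.1 | sim_applicable y.1.2 y.2 r])
  (x := snd) (f := fun y r _ => sim_perform (act r) (next r) y.2)); pr.
- by apply: (pr_comp3 (g := fun l c r => nat_of_bool (sim_applicable l c r)) pr_sim_applicable); pr.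
- apply: (pr_comp3 pr_sim_perform); pr; [simple apply pr_act|simple apply pr_next]; pr.
Qed.

Lemma pr_sim_run A {cA : coded A} (M : A -> seq quadruple) (l : A -> seq nat) (t : A -> nat) :
  pr M -> pr l -> pr t -> pr (fun a => sim_run (M a) (l a) (t a)).
Proof.
move=> pM pl pt; apply: pr_iter; pr.
by apply: (pr_comp3 pr_sim_step); pr; [apply: (pr_comp pM)|apply: (pr_comp pl)]; pr.
Qed.

Lemma pr_halted A {cA : coded A} (i : A -> nat) (l : A -> seq nat) (t : A -> nat) :
  pr i -> pr l -> pr t ->
  pr (fun a => nat_of_bool (halted (machine_of (i a)) (nth 0 (l a))
                              (run (machine_of (i a)) (nth 0 (l a)) (t a)))).
Proof.
move=> pi pl pt.
pose M a : seq quadruple := @decode _ (coded_seq coded_quadruple) (i a).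
have pM : pr M by apply: pr_decode.
apply: (@eq_pr _ _ _ _ (fun a =>
  if [seq r <- M a | sim_applicable (l a) (sim_run (M a) (l a) (t a)) r] is _ :: _ then 0 else 1)).
  move=> a; rewrite /M -machine_of_decode /halted -to_config_run.
  by rewrite -(eq_filter (sim_applicableE _ _)) has_filter; case: [seq _ <- _ | _].
apply: (pr_case_seq (f := fun _ _ _ => 0)); pr.
apply: (pr_comp3 (g := fun l c r => nat_of_bool (sim_applicable l c r)) pr_sim_applicable); pr.
  by apply: (pr_comp pl); pr.
by simple apply pr_sim_run; [apply: (pr_comp pM)|apply: (pr_comp pl)|apply: (pr_comp pt)]; pr.
Qed.

Lemma pr_output A {cA : coded A} (M : machine) (l : A -> seq nat) (t : A -> nat) :
  pr l -> pr t -> pr (fun a => output (run M (nth 0 (l a)) (t a))).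
Proof.
move=> pl pt; apply: (@eq_pr _ _ _ _ (fun a => rev (sim_run M (l a) (t a)).2)).
  by move=> a; rewrite -to_config_run.
by pr; simple apply pr_sim_run; pr.
Qed.

(** * Approximation by initial segments *)

(** Every number occupies at least one cell because of its final 2, so the first [h] cells after the
    blank are determined by the first [h] numbers. *)
Lemma input_symbol_local p p' h : (forall i, i < h -> p i = p' i) ->
  input_symbol p h = input_symbol p' h.
Proof.
case: h => //= j eqp; congr nth; rewrite /word; congr flatten.
by apply/eq_in_map=> i; rewrite mem_iota => lt; rewrite eqp.
Qed.

Lemma input_head_run M p t : input_head (run M p t) <= t.
Proof.
elim: t => // t IHt; rewrite /run iterS -/(run _ _ _) /step.
case: [seq _ <- _ | _] => [|r _]; first exact: leqW.
case: (run M p t) IHt => s h w o /= le.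
by case: (act r) => [[|i]|[|i]|i b|b] /=; lia.
Qed.

Lemma applicable_local p p' c : (forall i, i < input_head c -> p i = p' i) ->
  applicable p c =1 applicable p' c.
Proof.
move=> eqp r; rewrite /applicable /read; case: (scan r) => // .
by rewrite (input_symbol_local eqp).
Qed.

Lemma run_local M p p' t : (forall i, i < t -> p i = p' i) -> run M p t = run M p' t.
Proof.
elim: t => // t IHt eqp; rewrite /run !iterS -!/(run _ _ _) -IHt; last first.
  by move=> i lt; apply: eqp; apply: ltnW.
rewrite /step (@eq_filter _ _ (applicable p' (run M p t))) //.
apply: applicable_local => i lt; apply: eqp.
by have := input_head_run M p t; lia.
Qed.

Lemma halted_local M p p' t : (forall i, i < t -> p i = p' i) ->
  halted M p (run M p t) = halted M p' (run M p' t).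
Proof.
move=> eqp; rewrite -(run_local M eqp) /halted.
rewrite (@eq_has _ _ (applicable p' (run M p t))) //.
apply: applicable_local => i lt; apply: eqp.
by have := input_head_run M p t; lia.
Qed.

Lemma output_step_prefix M p c : prefix (output c) (output (step M p c)).
Proof.
rewrite /step; case: [seq _ <- _ | _] => [|r _]; first exact: prefix_refl.
case: c => s h w o.
by case: (act r) => [[|i]|[|i]|i b|b] /=; rewrite -?cats1 ?prefix_refl ?prefix_prefix.
Qed.

Lemma output_run_prefix M p t t' : t <= t' ->
  prefix (output (run M p t)) (output (run M p t')).
Proof.
move=> /subnKC <-; elim: (t' - t) => [|d IHd]; first by rewrite addn0 prefix_refl.
rewrite addnS /run iterS -/(run _ _ _); apply: prefix_trans IHd _.
exact: output_step_prefix.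
Qed.

(* Symbols other than 2 count as 1, and an unfinished last number is dropped. *)
Definition values (o : seq nat) : seq nat :=
  (foldl (fun z b => if b == 2 then (rcons z.1 z.2, 0) else (z.1, z.2.+1)) ([::], 0) o).1.

Lemma values_prefix o o' : prefix o o' -> prefix (values o) (values o').
Proof.
case/prefixP=> s ->; rewrite /values foldl_cat.
move: (foldl _ _ o) => z; elim: s z => [|b s IHs] z /=; first exact: prefix_refl.
apply: prefix_trans (IHs _); case: eqP => _ /=; last exact: prefix_refl.
by rewrite -cats1 prefix_prefix.
Qed.

Lemma values_word q n : values (word q n) = mkseq q n.
Proof.
suff: foldl (fun z b => if b == 2 then (rcons z.1 z.2, 0) else (z.1, z.2.+1))
    ([::], 0) (word q n) = (mkseq q n, 0) by rewrite /values => ->.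
elim: n => // n IHn; rewrite wordS foldl_cat IHn -cats1 foldl_cat.
have ones k l m : foldl (fun z b => if b == 2 then (rcons z.1 z.2, 0) else (z.1, z.2.+1))
    (l, m) (nseq k 1) = (l, m + k).
  by elim: k m => [|k IHk] m /=; rewrite ?addn0 // IHk addSnnS.
by rewrite ones /= mkseqS.
Qed.

(** Monotonicity makes everything that [Phi] has returned final. Correctness on the domain then
    needs no clause of its own; see [approximates_sound]. *)
Definition approximates (Phi : seq nat -> seq nat) (F : pfun baire baire) :=
  (forall l l', prefix l l' -> prefix (Phi l) (Phi l')) /\
  (forall p q, F p = Some q -> forall n, exists m, prefix (mkseq q n) (Phi (mkseq p m))).

Lemma prefix_mkseq (p : baire) m n : m <= n -> prefix (mkseq p m) (mkseq p n).
Proof.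
by move=> /subnKC <-; rewrite /mkseq iotaD map_cat prefix_prefix.
Qed.

(** This is continuity of [F]: [l] need not be a segment of [p]. [computable_lim_lift] uses it for
    members of a sequence that merely converges to [p]. *)
Lemma approximates_eventually Phi F p q n : approximates Phi F -> F p = Some q ->
  exists m0, forall l, prefix (mkseq p m0) l -> prefix (mkseq q n) (Phi l).
Proof.
move=> [mono app] Fp; have [m pm] := app _ _ Fp n.
by exists m => l /mono; apply: prefix_trans.
Qed.

Lemma prefix_nth (s1 s2 : seq nat) i : prefix s1 s2 -> i < size s1 -> nth 0 s2 i = nth 0 s1 i.
Proof. by case/prefixP=> s -> lt; rewrite nth_cat lt. Qed.

(** A sufficiently long segment gives the right value at [k], and by monotonicity it only extends
    what the shorter one gave. *)
Lemma approximates_sound Phi F p q m k : approximates Phi F -> F p = Some q ->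
  k < size (Phi (mkseq p m)) -> nth 0 (Phi (mkseq p m)) k = q k.
Proof.
move=> app Fp lt; have [m0 ev] := approximates_eventually k.+1 app Fp.
have e1 := ev _ (prefix_mkseq p (leq_maxl m0 m)).
have e2 := app.1 _ _ (prefix_mkseq p (leq_maxr m0 m)).
rewrite -(prefix_nth e2 lt) (prefix_nth e1) ?size_mkseq //.
by rewrite nth_mkseq.
Qed.

Lemma approximates_size Phi F p q k : approximates Phi F -> F p = Some q ->
  exists m0, forall m, m0 <= m -> k < size (Phi (mkseq p m)).
Proof.
move=> app Fp; have [m0 ev] := approximates_eventually k.+1 app Fp.
exists m0 => m /(prefix_mkseq p)/ev/prefixP[s ->].
by rewrite size_cat size_mkseq addSn ltnS leq_addr.
Qed.

Lemma computable_approximates F : computable F ->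
  exists2 Phi, pr Phi & approximates Phi F.
Proof.
case=> M comp.
exists (fun l => values (output (run M (nth 0 l) (size l)))).
  apply: pr_fst; apply: pr_foldl; pr; simple apply pr_output; pr.
split=> [l l' pl|p q Fp n].
  apply: values_prefix; rewrite (@run_local _ _ (nth 0 l')).
    by apply: output_run_prefix; apply: size_prefix.
  by move=> i lt; rewrite (prefix_nth pl).
have [t pt] := comp _ _ Fp n; exists t.
rewrite size_mkseq -(@run_local _ p) => [|i lt]; last by rewrite nth_mkseq.
by rewrite -values_word; apply: values_prefix.
Qed.

(** The program itself is a constant; each increment of [i] puts the two quadruples of one [Incr 1]
    in front, so the chain is a plain iteration. *)
Lemma pr_stream_machine c : pr (fun i => stream_machine c i : seq quadruple).
Proof.
rewrite /stream_machine; set s := stream_start c.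
apply: pr_cons; first by simple apply pr_quadruple; pr.
pose C0 : seq quadruple := compile (stream_command c) s s.-1 1.
pose step (z : nat * seq quadruple) : nat * seq quadruple :=
  (z.1.+1, Quadruple (s + z.1.+1) (Work 1) 0 (Write 1 1) (s + z.1.+1)
        :: Quadruple (s + z.1.+1) (Work 1) 1 (MoveRight (Work 1)) (s + z.1) :: z.2).
apply: (@eq_pr _ _ _ _ (fun i => (iter i step (0, C0)).2)).
  have E i : iter i step (0, C0) = (i, stream_chain c i) by elim: i => //= i ->.
  by move=> i; rewrite E.
by rewrite /step; pr; simple apply pr_quadruple; pr.
Qed.

Section TypedStream.
Context {S : Type} {cS : coded S}.
Variable step : nat * S -> S * nat.
Hypothesis pr_step : pr step.

Section Trajectory.
Variables (p : baire) (s0 : S).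

Fixpoint trajectory (n : nat) : S :=
  if n is m.+1 then (step (p m, trajectory m)).1 else s0.

Definition signal (n : nat) : nat := (step (p n, trajectory n)).2.

End Trajectory.

(** The s-m-n theorem in the form needed: the index is computed from the initial state [s]. The
    clause on halting provides questions to the jump, the clause on the output provides computable
    functions. *)
Lemma stream_exists : exists2 e : S -> nat, pr e & forall s p,
  (halts (machine_of (e s)) p <-> exists n, signal p s n = 1) /\
  (forall n, (forall k, k < n -> signal p s k != 1) -> exists t,
    output (run (machine_of (e s)) p t) =
    flatten [seq emission (signal p s k) | k <- iota 0 n]).
Proof.
have [c cP] := prec_in_place pr_step.
exists (fun s => code_machine (stream_machine c (code s))) => [|s p].
  apply: (@eq_pr _ _ _ _ (fun s => code (stream_machine c (code s) : seq quadruple))).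
    by move=> s; rewrite code_machineE.
  by apply: pr_code; apply: (pr_comp (pr_stream_machine c)); apply: pr_code; pr.
rewrite code_machineK.
set g := fun c => code _ in cP.
have gE x s' : g (pair_nat x (code s')) = pair_nat (code (step (x, s')).1) (step (x, s')).2.
  by rewrite /g /= /decode_pair pair_natK /= codeK.
have stE n : stream_state g p (code s) n = code (trajectory p s n).
  by elim: n => //= n ->; rewrite gE pair_natK.
have valE : stream_value g p (code s) =1 signal p s.
  by move=> n; rewrite /stream_value stE gE pair_natK.
split=> [|n n1].
  rewrite (stream_halts cP); split=> -[n e]; exists n; by rewrite -e valE.
have [|t _ [w E _]] := @stream_run _ _ cP p (code s) n.
  by move=> k lt; rewrite valE n1.
by exists t; rewrite E /= /stream_output (eq_map (fun k => congr1 emission (valE k))).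
Qed.

End TypedStream.

Lemma mkseq_rev (p : baire) n : rev (p n :: rev (mkseq p n)) = mkseq p n.+1.
Proof. by rewrite rev_cons revK mkseqS. Qed.

(** The machine keeps what it has read and the index [k] of the next value to write, and consults
    [psi] once per number read. As [psi] may answer at some lengths only, and these may have passed
    when [k] is due, answers must recur at arbitrarily large lengths. *)
Lemma computable_of_approximations (psi : seq nat -> nat -> option nat) (F : pfun baire baire) :
  pr (fun y => psi y.1 y.2) ->
  (forall p q, F p = Some q ->
    (forall n k v, psi (mkseq p n) k = Some v -> v = q k) /\
    (forall k n, exists2 m, n <= m & psi (mkseq p m) k = Some (q k))) ->
  computable F.
Proof.
move=> ppsi psiF.
pose step (y : nat * (seq nat * nat)) :=
  if psi (rev (y.1 :: y.2.1)) y.2.2 is Some v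
  then ((y.1 :: y.2.1, y.2.2.+1), v.+2) else ((y.1 :: y.2.1, y.2.2), 0).
have pstep : pr step.
  apply: (pr_case_option (o := fun y => psi (rev (y.1 :: y.2.1)) y.2.2)
    (f := fun y v => ((y.1 :: y.2.1, y.2.2.+1), v.+2))); pr.
  by apply: (pr_comp2 ppsi); pr.
have [e _ eP] := stream_exists pstep.
exists (machine_of (e ([::], 0))) => p q /psiF[sound ev].
have {eP} [_ out] := eP ([::], 0) p.
have {}out n : exists t, output (run (machine_of (e ([::], 0))) p t) =
    flatten [seq emission (signal step p ([::], 0) k) | k <- iota 0 n].
  by apply: out => k _; rewrite /signal /step; case: (psi _ _).
set s0 := ([::], 0) in out *.
pose K n := (trajectory step p s0 n).2.
have trE n : (trajectory step p s0 n).1 = rev (mkseq p n).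
  by elim: n => //= n IHn; rewrite /step; case: (psi _ _) => [v|] /=;
    rewrite IHn -mkseq_rev revK.
have stepE n : step (p n, trajectory step p s0 n) =
    if psi (mkseq p n.+1) (K n) is Some v
    then ((rev (mkseq p n.+1), (K n).+1), v.+2) else ((rev (mkseq p n.+1), K n), 0).
  by rewrite /step /= trE mkseq_rev -(mkseq_rev p n) revK.
have outE n : flatten [seq emission (signal step p s0 k) | k <- iota 0 n] = word q (K n).
  elim: n => // n IHn; rewrite -addn1 iotaD map_cat flatten_cat IHn addn1 /= cats0 add0n.
  rewrite /signal /K /= stepE; case E: (psi _ _) => [v|] /=; last by rewrite cats0.
  by rewrite wordS -(sound _ _ _ E).
have Kmono m n : m <= n -> K m <= K n.
  move=> /subnKC <-; elim: (n - m) => [|d IHd]; first by rewrite addn0.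
  rewrite addnS {2}/K /= stepE; case: (psi _ _) => [v|] //=; exact: leqW.
have Kbig k : exists n, k <= K n.
  elim: k => [|k [n le]]; first by exists 0.
  have [lt|] := ltnP k (K n); first by exists n.
  move=> ge; have {ge} Kn : K n = k by lia.
  have [m lem psim] := ev k n.+1.
  case: m lem psim => // m; rewrite ltnS => lem psim.
  exists m.+1; have := Kmono _ _ lem; rewrite Kn leq_eqVlt => /orP[/eqP Km|lt].
    by rewrite /K /= stepE -Km psim.
  by apply: leq_trans lt _; apply: Kmono.
move=> n; have [m le] := Kbig n; have [t tE] := out m; exists t.
by rewrite tE outE; apply: word_prefix.
Qed.

(** The index depends on [i] alone, so it is found without access to [p]. Tests begin at length 1,
    because a stream machine reads before it decides. *)
Lemma semidecidable_jump (chi : seq nat -> nat -> bool) :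
  pr (fun y => nat_of_bool (chi y.1 y.2)) ->
  exists2 e : nat -> nat, pr e &
    forall p i, jump p (e i) = ~~ `[< forall n, ~~ chi (mkseq p n.+1) i >].
Proof.
move=> pchi.
pose step (y : nat * (seq nat * nat)) :=
  ((y.1 :: y.2.1, y.2.2), nat_of_bool (chi (rev (y.1 :: y.2.1)) y.2.2)).
have pstep : pr step.
  by rewrite /step; pr; apply: (pr_comp2 (g := fun l i => nat_of_bool (chi l i)) pchi); pr.
have [e pe eP] := stream_exists pstep.
exists (fun i => e ([::], i)) => [|p i]; first by apply: (pr_comp pe); pr.
have [haltE _] := eP ([::], i) p; rewrite /jump (asbool_equiv_eq haltE).
have sE n : signal step p ([::], i) n = chi (mkseq p n.+1) i.
  suff trE : trajectory step p ([::], i) n = (rev (mkseq p n), i).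
    by rewrite /signal /= trE /= mkseq_rev.
  by elim: n => //= n ->; rewrite /= -mkseq_rev revK.
congr nat_of_bool; rewrite -asbool_neg; apply: asbool_equiv_eq; split.
  by case=> n; rewrite sE => c1 /(_ n); case: (chi _ _) c1.
by move=> /existsNP[n /negP/negPn c]; exists n; rewrite sE c.
Qed.

(** * Limits and jumps *)

Lemma lim_baireE p q : lim_baire p = Some q <->
  forall k, exists N, forall n, N <= n -> p (pair_nat n k) = q k.
Proof.
rewrite lim_baireP pointwise_cvgP; split=> [cvg k|ev k].
  have /discrete_cvg [N _ NP] := cvg k.
  by exists N => n le; apply: NP.
by apply/discrete_cvg; have [N NP] := ev k; exists N => // n; apply: NP.
Qed.

Lemma pair_nat_leq n j k : (pair_nat n j <= pair_nat n k) = (j <= k).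
Proof.
have mono a b : a <= b -> pair_nat n a <= pair_nat n b.
  by move=> le; apply: leq_add => //; apply/half_leq/leq_mul; rewrite ?ltnS leq_add2l.
have [/mono//|lt] := leqP j k; apply/negbTE; rewrite -ltnNge.
apply: leq_trans (mono _ _ lt); rewrite ltnNge; apply/negP=> le.
have /(congr1 (fun c => (unpair_nat c).2)) : pair_nat n k = pair_nat n k.+1.
  by apply/eqP; rewrite eqn_leq le mono.
by rewrite !pair_natK /=; lia.
Qed.

(** The point [p] is never recovered from [jump p]: [Phi] is evaluated only inside the machines that
    are asked about, and the computation reads nothing but the answers. *)
Lemma computable_lim_jump_inv G : computable G ->
  computable (pcomp (pcomp lim_baire G) jump_inv).
Proof.
move=> /computable_approximates[Phi pPhi app].
(* [i] codes [k], [N] and [v]; the machine [e i] looks for [j >= N] with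
   [G(p)<j,k> <> v].  Reading [j] off the length of the segment makes every [j]
   return infinitely often, and likewise for the candidates [c] below. *)
pose chi l i := let j := (unpair_nat (size l)).1 in
  let c := pair_nat j (unpair_nat i).1 in
  ((unpair_nat (unpair_nat i).2).1 <= j) && (c < size (Phi l)) &&
  (nth 0 (Phi l) c != (unpair_nat (unpair_nat i).2).2).
have [|e pe eP] := @semidecidable_jump chi.
  by rewrite /chi; pr; apply: (pr_comp pPhi); pr.
(* [c] codes a bound [N] and a value [v], and entry 0 of the jump says that the search fails. The
   test [m < size s] keeps the default value of [nth] from passing for such an answer. *)
pose psi s k := let c := (unpair_nat (size s)).1 in
  let m := e (pair_nat k c) in
  if (m < size s) && (nth 0 s m == 0) then Some (unpair_nat c).2 else None.
apply: (@computable_of_approximations psi).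
  by rewrite /psi; pr; apply: (pr_comp pe); pr.
move=> r q; rewrite /pcomp; case E: (jump_inv r) => [p|] //=.
have /jump_invP <- := E; case Gp: (G p) => [h|] //= /lim_baireE hq.
(* A length [pair_nat j _] directs the search to [j]; the second component makes the segment long
   enough, and [m0.+1] also makes the length positive. *)
have valueP j k : exists n, [/\ (unpair_nat n.+1).1 = j,
    pair_nat j k < size (Phi (mkseq p n.+1)) &
    nth 0 (Phi (mkseq p n.+1)) (pair_nat j k) = h (pair_nat j k)].
  have [m0 sz] := approximates_size (pair_nat j k) app Gp.
  have [_ le] := leq_pair_nat j m0.+1.
  exists (pair_nat j m0.+1).-1; rewrite prednK; last by lia.
  have lt : pair_nat j k < size (Phi (mkseq p (pair_nat j m0.+1))) by apply: sz; lia.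
  by rewrite pair_natK (approximates_sound app Gp lt).
split=> [n k v|k n0].
  rewrite /psi size_mkseq; set c := (unpair_nat n).1; set m := e _.
  case: ifP => // /andP[lt]; rewrite nth_mkseq // eP.
  case: asboolP => // never _ [<-].
  have [N hN] := hq k.
  (* Beyond both the bound of the candidate and the true one, the sequence shows its limit, and the
     failed search says that it shows [v]. *)
  have [n' [n'1 sz val]] := valueP (maxn (unpair_nat c).1 N) k.
  have := never n'; rewrite /chi size_mkseq n'1 !pair_natK /= sz val leq_maxl /=.
  by rewrite negbK => /eqP <-; apply: hN; apply: leq_maxr.
(* For a true bound and the true value the search fails, and the lengths [pair_nat c _] propose this
   candidate again and again. *)
have [N hN] := hq k; pose c := pair_nat N (q k); pose m := e (pair_nat k c).
have [_ le] := leq_pair_nat c (maxn n0 m.+1).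
exists (pair_nat c (maxn n0 m.+1)); first by lia.
rewrite /psi size_mkseq pair_natK /= -/m nth_mkseq; last by lia.
rewrite eP; case: asboolP => [_|[]].
  by rewrite pair_natK /= ifT // andbT; lia.
move=> n; rewrite /chi !pair_natK /=.
apply/negP=> /andP[/andP[leN lt] /negP[]].
by rewrite (approximates_sound app Gp lt) hN.
Qed.

(** [K'] can be total: where [Phi] has not yet returned an entry, the default 0 is written, and
    finitely many wrong stages do not affect a limit. *)
Lemma computable_lim_lift K : computable K -> exists2 K', computable K' &
  forall r x y, lim_baire r = Some x -> K x = Some y ->
  exists2 r', K' r = Some r' & lim_baire r' = Some y.
Proof.
move=> /computable_approximates[Phi pPhi app].
pose K0 (r : baire) c := let n := (unpair_nat c).1 in
  nth 0 (Phi (mkseq (column r n) n)) (unpair_nat c).2.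
exists (fun r => Some (K0 r)).
  (* Positions [pair_nat n j] with [j < n] lie below [pair_nat n n], so the whole segment of the
     [n]-th member is available. *)
  pose psi s c := let n := (unpair_nat c).1 in if pair_nat n n <= size s then
    Some (nth 0 (Phi (mkseq (fun j => nth 0 s (pair_nat n j)) n)) (unpair_nat c).2) else None.
  apply: (@computable_of_approximations psi).
    by rewrite /psi; pr; apply: (pr_comp pPhi); pr.
  move=> p _ [<-].
  have colE n m : pair_nat n n <= m ->
      mkseq (fun j => nth 0 (mkseq p m) (pair_nat n j)) n = mkseq (column p n) n.
    move=> le; apply/eq_in_map=> j; rewrite mem_iota => /andP[_ lt].
    rewrite nth_mkseq //; apply: leq_trans le.
    by rewrite ltnNge pair_nat_leq -ltnNge.
  split=> [m c v|c m].
    by rewrite /psi size_mkseq; case: ifP => // le [<-]; rewrite colE.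
  pose n := (unpair_nat c).1; exists (maxn m (pair_nat n n)); first exact: leq_maxl.
  by rewrite /psi size_mkseq leq_maxr colE // leq_maxr.
move=> r x y /lim_baireE rx Kx; exists (K0 r) => //; apply/lim_baireE => k.
have [m0 ev] := approximates_eventually k.+1 app Kx.
have [N NP] : exists N, forall n, N <= n -> forall j, j < m0 -> column r n j = x j.
  elim: m0 {ev} => [|m [N NP]]; first by exists 0.
  have [N' N'P] := rx m; exists (maxn N N') => n; rewrite geq_max => /andP[le le'] j.
  rewrite ltnS leq_eqVlt => /orP[/eqP->|lt]; [exact: N'P|exact: NP].
exists (maxn N m0) => n; rewrite geq_max => /andP[le le0].
rewrite /K0 pair_natK /= (@prefix_nth (mkseq y k.+1)) ?size_mkseq ?nth_mkseq //.
apply: ev; apply: prefix_trans (prefix_mkseq _ le0).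
rewrite (_ : mkseq (column r n) m0 = mkseq x m0) ?prefix_refl //.
by apply/eq_in_map=> j; rewrite mem_iota => /andP[_ lt]; apply: NP.
Qed.

(** The bound [n./2] leaves room for dropping every other number in [computable_rel_of_computable];
    the approximations of jumps lose nothing. *)
Lemma computable_precomp F G g : computable F -> pr g ->
  (forall p q, G p = Some q -> forall n, exists2 m, n./2 <= m &
    g (mkseq p n) = mkseq q m) ->
  computable (pcomp F G).
Proof.
move=> /computable_approximates[Phi pPhi app] pg gG.
pose psi s k := if k < size (Phi (g s)) then Some (nth 0 (Phi (g s)) k) else None.
apply: (@computable_of_approximations psi).
  by rewrite /psi; pr; apply: (pr_comp pPhi); apply: (pr_comp pg); pr.
move=> p q; rewrite /pcomp; case Gp: (G p) => [h|] //= Fh; split=> [n k v|k n].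
  have [m _ E] := gG _ _ Gp n.
  by rewrite /psi E; case: ifP => // lt [<-]; rewrite (approximates_sound app Fh lt).
have [m0 sz] := approximates_size k app Fh.
exists (maxn n m0.*2); first exact: leq_maxl.
have [m le E] := gG _ _ Gp (maxn n m0.*2).
have lt : k < size (Phi (mkseq h m)).
  apply: sz; apply: leq_trans le; rewrite -{1}[m0]doubleK.
  by apply: half_leq; apply: leq_maxr.
by rewrite /psi E lt (approximates_sound app Fh lt).
Qed.

(** Column [n] records which machines have halted after [n] steps; halting is permanent, so the
    columns converge to the jump. *)
Definition jump_approx (p : baire) : baire := fun c =>
  let M := machine_of (unpair_nat c).2 in halted M p (run M p (unpair_nat c).1).

Lemma lim_jump_approx p : lim_baire (jump_approx p) = Some (jump p).
Proof.
apply/lim_baireE => k; rewrite /jump /jump_approx; case: asboolP => [[t ht]|nh].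
  by exists t => n le; rewrite pair_natK /= (halted_run ht le) ht.
exists 0 => n _; rewrite pair_natK /=; case: (boolP (halted _ _ _)) => // hn.
by case: nh; exists n.
Qed.

Lemma jump_approx_local p p' c : (forall i, i < c -> p i = p' i) ->
  jump_approx p c = jump_approx p' c.
Proof.
move=> eqp; congr nat_of_bool; apply: halted_local => i lt; apply: eqp.
by apply: leq_trans lt _; case: (unpair_nat_le c).
Qed.

Lemma pr_jump_approx A {cA : coded A} (l : A -> seq nat) (c : A -> nat) :
  pr l -> pr c -> pr (fun a => jump_approx (nth 0 (l a)) (c a)).
Proof. by move=> pl pc; apply: pr_halted; pr. Qed.

(** Even positions run the stages on the zero sequence, whose jump is the oracle; odd positions run
    them on [p]. *)
Definition join_jump_approx (p : baire) : baire := fun c =>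
  let n := (unpair_nat c).1 in let j := (unpair_nat c).2 in
  jump_approx (if odd j then p else fun=> 0) (pair_nat n j./2).

Lemma lim_join_jump_approx p :
  lim_baire (join_jump_approx p) = Some (join_baire halting_problem (jump p)).
Proof.
apply/lim_baireE => k.
have /lim_baireE/(_ k./2)[N NP] := lim_jump_approx (if odd k then p else fun=> 0).
exists N => n /NP; rewrite /join_jump_approx pair_natK /= => ->.
by rewrite /join_baire; case: ifP.
Qed.

Lemma computable_comp_jump_approx F : computable F ->
  computable (pcomp F (fun p => Some (jump_approx p))).
Proof.
move=> cF; apply: (@computable_precomp _ _ (fun l => mkseq (jump_approx (nth 0 l)) (size l))) => //.
  by pr; simple apply pr_jump_approx; pr.
move=> p _ [<-] n; exists n; first by lia.
rewrite size_mkseq; apply/eq_in_map=> c; rewrite mem_iota => /andP[_ lt].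
by apply: jump_approx_local => i lti; rewrite nth_mkseq //; apply: ltn_trans lt.
Qed.

Lemma computable_comp_join_jump_approx F : computable F ->
  computable (pcomp F (fun p => Some (join_jump_approx p))).
Proof.
(* The empty word, continued by zeros, is the input of the halting problem. *)
move=> cF; pose g (l : seq nat) := mkseq (fun c =>
  let n := (unpair_nat c).1 in let j := (unpair_nat c).2 in
  jump_approx (nth 0 (if odd j then l else [::])) (pair_nat n j./2)) (size l).
apply: (@computable_precomp _ _ g) => //.
  by rewrite /g; pr; simple apply pr_jump_approx; pr.
move=> p _ [<-] n; exists n; first by lia.
rewrite /g size_mkseq; apply/eq_in_map=> c; rewrite mem_iota => /andP[_ lt].
apply: jump_approx_local => i lti; case: ifP => _; last by rewrite nth_nil.
rewrite nth_mkseq //; apply: leq_trans lti _; apply: leq_trans (ltnW lt).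
have := unpair_natK c; case: (unpair_nat c) => a j /= <-.
by rewrite pair_nat_leq; lia.
Qed.

Lemma computable_rel_of_computable r F : computable F -> computable_rel r F.
Proof.
move=> cF; pose G : pfun baire baire := fun p => Some (fun n => p n.*2.+1).
exists (pcomp F G) => [|p _].
  pose g (l : seq nat) := mkseq (fun n => nth 0 l n.*2.+1) (size l)./2.
  apply: (@computable_precomp _ _ g) => //.
    rewrite /g; pr.
    apply: (@eq_pr _ _ _ _ (fun y : seq nat * nat => y.2 + y.2)); last by pr.
    by move=> y; rewrite addnn.
  move=> p _ [<-] n; exists n./2 => //; rewrite /g size_mkseq.
  apply/eq_in_map=> i; rewrite mem_iota => /andP[_ lt]; rewrite nth_mkseq //.
  by have := odd_double_half n; lia.
rewrite /pcomp /G /=; congr F; apply/funext=> n.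
by rewrite /join_baire /= odd_double uphalf_double.
Qed.

(** * Passing between names in the changed representations *)

Section Equivalences.
Variables (X Y : rep_space) (f : problem X Y).

Lemma pcompA A B C D (H : pfun C D) (G : pfun B C) (F : pfun A B) :
  pcomp (pcomp H G) F = pcomp H (pcomp G F).
Proof. by apply/funext=> a; rewrite /pcomp; case: (F a). Qed.

Lemma pcomp_some A B C (G : pfun B C) (F : pfun A B) a c :
  pcomp G F a = Some c <-> exists2 b, F a = Some b & G b = Some c.
Proof.
rewrite /pcomp; case: (F a) => [b|] /=; last by split=> // -[].
by split=> [Gb|[_ [<-]]//]; exists b.
Qed.

Lemma realizer_low_space (Z : rep_space) (h : problem Z Y) F :
  @realizer Z (low_space Y) F h <-> @realizer Z Y (pcomp low_map F) h.
Proof.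
have E : pcomp (@repr (low_space Y)) F = pcomp (@repr Y) (pcomp low_map F).
  exact: pcompA.
by rewrite /realizer E.
Qed.

Lemma low_iff_computable_low_space : problem_low f <-> @problem_computable X (low_space Y) f.
Proof.
split=> [[F [G cG ->]]|[G cG]]; last first.
  by move=> /realizer_low_space rG; exists (pcomp low_map G) => //; exists G.
by move=> rG; exists G => //; apply/realizer_low_space.
Qed.

(** A name in [low_space Y] is a sequence whose limit is a name in [jump_space Y]; so the limit is
    taken after [F], and the jump is undone before it. *)
Lemma computable_jump_of_low : @problem_computable X (low_space Y) f ->
  @problem_computable (jump_space X) (jump_space Y) f.
Proof.
move=> [F cF rF]; exists (pcomp (pcomp lim_baire F) jump_inv).
  exact: computable_lim_jump_inv.
move=> r x /pcomp_some[p rp px] fx; have [y + fy] := rF p x px fx.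
move=> yE; exists y => //; move: yE; rewrite /= /low_map.
rewrite /pcomp rp /=; case: (F p) => //= s; by case: (lim_baire s).
Qed.

Lemma low_low_of_jump_jump : @problem_computable (jump_space X) (jump_space Y) f ->
  @problem_computable (low_space X) (low_space Y) f.
Proof.
move=> [K /computable_lim_lift[K' cK' KK'] rK]; exists K' => // r x.
move=> /pcomp_some[p /pcomp_some[s rs sp] px] fx.
have [|y + fy] := rK s x _ fx; first by apply/pcomp_some; exists p.
move=> /pcomp_some[u Ks uy]; have [r' Kr r'u] := KK' _ _ _ rs Ks.
exists y => //; apply/pcomp_some; exists r' => //.
have /pcomp_some[z uz zy] := uy.
by apply/pcomp_some; exists z => //; apply/pcomp_some; exists u.
Qed.

(** If [p] is a name of [x], then [jump_approx p] is a name of [x] in [low_space X]. *)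
Lemma low_of_low_low : @problem_computable (low_space X) (low_space Y) f ->
  @problem_computable X (low_space Y) f.
Proof.
move=> [F cF rF]; exists (pcomp F (fun p => Some (jump_approx p))).
  exact: computable_comp_jump_approx.
move=> p x px fx; apply: (rF _ _ _ fx).
apply/pcomp_some; exists p => //; apply/pcomp_some; exists (jump p).
  exact: lim_jump_approx.
exact/jump_invP.
Qed.

(** The lifted function is [G], which takes the oracle as part of its input; both parts of that
    input are supplied as limits of one computable sequence. *)
Lemma low_of_jump_jump_rel :
  @problem_computable_rel halting_problem (jump_space X) (jump_space Y) f ->
  @problem_computable X (low_space Y) f.
Proof.
move=> [F [G /computable_lim_lift[K cK GK] FG] rF].
exists (pcomp K (fun p => Some (join_jump_approx p))).
  exact: computable_comp_join_jump_approx.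
move=> p x px fx.
have [|y + fy] := rF (jump p) x _ fx.
  by apply/pcomp_some; exists p => //; apply/jump_invP.
move=> /pcomp_some[s Fs /pcomp_some[z sz zy]]; exists y => //.
have Gs : G (join_baire halting_problem (jump p)) = Some s by rewrite -FG //; exists s.
have [r' Kr r's] := GK _ _ _ (lim_join_jump_approx p) Gs.
apply/pcomp_some; exists r' => //.
by apply/pcomp_some; exists z => //; apply/pcomp_some; exists s.
Qed.

End Equivalences.

Theorem theorem4p7 (X Y : rep_space) (f : problem X Y) :
  [<-> @problem_low X Y f;
       @problem_computable X (low_space Y) f;
       @problem_computable (low_space X) (low_space Y) f;
       @problem_computable (jump_space X) (jump_space Y) f;
       @problem_computable_rel halting_problem (jump_space X) (jump_space Y) f].
Proof.
(* The direct implications are (2) to (4), (4) to (3), (3) to (2) and (5) to (2); two steps of the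
   cycle are composites of these. *)
tfae.
- by move/low_iff_computable_low_space.
- by move/computable_jump_of_low/low_low_of_jump_jump.
- by move/low_of_low_low/computable_jump_of_low.
- by move=> [F cF rF]; exists F => //; apply: computable_rel_of_computable.
- by move/low_of_jump_jump_rel/low_iff_computable_low_space.
Qed.
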